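(* Let $G$ be a bridgeless cubic graph. Then $G$ admits a $6$-edge-coloring $f$ such that $|E(f)|\geq \frac{7}{9}\cdot |E(G)|$.
   Context: Graphs are finite, undirected, without loops, possibly with parallel edges. A $6$-edge-coloring is a proper edge-coloring with colors from $\{1,\dots,6\}$. For an edge-coloring $c$ and a vertex $v$, let $S_c(v)$ be the set of colors on edges incident with $v$. An edge $uv$ of a cubic graph is poor if $|S_c(u)\cup S_c(v)|=3$, rich if $|S_c(u)\cup S_c(v)|=5$, and normal if it is poor or rich. $E(f)$ denotes the set of edges that are normal with respect to the edge-coloring $f$. *)

(* Defs.v *)
From mathcomp Require Import all_boot all_order all_algebra.

Set Implicit Arguments.
Unset Strict Implicit.
Unset Printing Implicit Defensive.

(* Finite undirected multigraphs: edges form a type of their own, so parallel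
   edges are allowed; an edge has exactly two endvertices, so loops are not. *)
Record multigraph := Multigraph {
  vertex : finType;
  edge : finType;
  ends : edge -> {set vertex};
  card_ends : forall e : edge, #|ends e| = 2
}.

Section Graph.
Variable G : multigraph.

Definition incident (v : vertex G) : {set edge G} := [set e | v \in ends e].

Definition cubic : Prop := forall v : vertex G, #|incident v| = 3.

(* Adjacency in the spanning subgraph of G with edge set F. *)
Definition adj (F : {set edge G}) : rel (vertex G) :=
  fun u v => [exists e in F, ends e == [set u; v]].

Definition num_components (F : {set edge G}) : nat :=
  n_comp (adj F) (vertex G).

(* A bridge is an edge whose deletion increases the number of components. *)
Definition is_bridge (e : edge G) : bool :=
  num_components [set: edge G] < num_components [set~ e].

Definition bridgeless : Prop := forall e : edge G, ~~ is_bridge e.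

(* The k colours are taken to be 0, ..., k - 1. *)
Definition edge_coloring (k : nat) (f : edge G -> 'I_k) : Prop :=
  forall (v : vertex G) (e1 e2 : edge G),
    e1 \in incident v -> e2 \in incident v -> e1 != e2 -> f e1 != f e2.

Section Colors.
Variables (k : nat) (f : edge G -> 'I_k).

Definition colors_at (v : vertex G) : {set 'I_k} := f @: incident v.

(* For an edge e = uv, the union of colors_at u and colors_at v. *)
Definition colors_around (e : edge G) : {set 'I_k} :=
  \bigcup_(v in ends e) colors_at v.

Definition poor (e : edge G) : bool := #|colors_around e| == 3.
Definition rich (e : edge G) : bool := #|colors_around e| == 5.

Definition normal_edges : {set edge G} := [set e | poor e || rich e].

End Colors.
End Graph.

(* Main.v *)
Require Import Defs.
From mathcomp Require Import all_boot all_order all_algebra.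
From mathcomp Require Import zify lra.

Set Implicit Arguments.
Unset Strict Implicit.
Unset Printing Implicit Defensive.

Import Order.TTheory GRing.Theory Num.Theory.

(* Suppose that [M] is a perfect matching and [y] a flow with values in the Klein
   group that vanishes nowhere on [M]. Color the edges outside [M] by their values
   (4 colors) and those of [M] by their values (3 further colors). Around a vertex
   one sees [m], [a] and [a + m], so this is a proper 7-coloring, and every edge is
   normal. Merge the two colors of [M] other than [p]: the edges of [M] stay
   normal, and an edge outside [M] is spoiled only if the values [m], [n] of the
   edges of [M] at its ends satisfy [p = m + n]. Hence each of the [2/3 |E|] edges
   outside [M] is spoiled for at most one of the three choices of [p], and some [p]
   spoils at most [2/9 |E|] edges.

   The flow exists as soon as no 3-edge cut is contained in [M]. Dropping one edge
   of every 2-edge cut contained in [M] leaves a set [N] in which every nonempty cut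
   has at least 4 edges; by matroid union, [N] contains two disjoint sets [A], [B]
   that span the graph once the edges outside [N] are contracted, and [N :\: A] and
   [N :\: B] extend to binary flows that do not vanish simultaneously on [N].

   A perfect matching containing no 3-edge cut is obtained by contracting the sides
   of a nontrivial 3-edge cut and gluing matchings of the two contractions; when
   there is no such cut, any perfect matching will do. To glue, one must be able to
   prescribe one edge of the matching. *)

(** * Counting in finite types *)

Lemma card_sum_mem (T : finType) (B : {set T}) : #|B| = \sum_x (x \in B).
Proof. by rewrite -sum1_card big_mkcond. Qed.

(** Used to compare, edge by edge, a sum of sizes of disjoint sets with the size of a set that
    contains them. *)
Lemma sum_bool_le1 (T : finType) (A : {set T}) (F : pred T) (b : bool) :
  {in A, forall x, F x -> b} ->
  {in A &, forall x y, F x -> F y -> x = y} -> \sum_(x in A) F x <= b.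
Proof.
move=> Fb Finj.
have -> : \sum_(x in A) F x = #|[set x in A | F x]|.
  rewrite -sum1_card big_mkcond [RHS]big_mkcond; apply: eq_bigr => x _.
  by rewrite !inE; case: (_ \in A); case: (F x).
have [->|[x]] := set_0Vmem [set x in A | F x]; first by rewrite cards0.
rewrite inE => /andP[Ax Fx]; rewrite (Fb x) //; apply/card_le1_eqP=> y z.
by rewrite !inE => /andP[Ay Fy] /andP[Az Fz]; apply: Finj.
Qed.

Lemma connect_ind (T : finType) (r : rel T) (P : T -> Prop) x : P x ->
  (forall y z, connect r x y -> P y -> r y z -> P z) ->
  forall y, connect r x y -> P y.
Proof.
move=> Px Pr y /connectP[s + ->]; elim/last_ind: s {y} => [|s y IH] //=.
rewrite rcons_path last_rcons => /andP[xs ry].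
by apply: Pr (IH xs) ry; apply/connectP; exists s.
Qed.

Lemma card_set_undup (T : finType) (s : seq T) : #|[set x in s]| = size (undup s).
Proof. by rewrite cardsE -(eq_card (mem_undup s)); apply/card_uniqP/undup_uniq. Qed.

Lemma set_cat (T : finType) (l1 l2 : seq T) :
  [set x in l1] :|: [set x in l2] = [set x in l1 ++ l2].
Proof. by apply/setP=> x; rewrite !inE mem_cat. Qed.

(** * Maximum matchings *)

(** The points of [Y] that [f] moves split into pairs [y], [f y]; the induction removes one pair at
    a time. *)
Lemma odd_card_involution (T : finType) (f : T -> T) (Y : {set T}) :
  involutive f -> {in Y, forall y, f y \in Y} ->
  odd #|[set y in Y | f y == y]| = odd #|Y|.
Proof.
move=> fK; have [n] := ubnP #|Y|; elim: n Y => // n IHn Y ltYn fY.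
have [fixY|] := boolP [forall y in Y, f y == y].
  congr (odd #|pred_of_set _|); apply/setP=> y; rewrite inE.
  by have [/(forall_inP fixY)->|] := boolP (y \in Y).
rewrite negb_forall_in => /exists_inP[y Yy nfy].
have Yfy : f y \in Y :\ y by rewrite !inE nfy fY.
rewrite (cardsD1 y Y) Yy (cardsD1 (f y) (Y :\ y)) Yfy !oddD /= negbK.
rewrite -(IHn (Y :\ y :\ f y)).
- congr (odd #|pred_of_set _|); apply/setP=> z; rewrite !inE.
  have [->|_] := eqVneq z y; first by rewrite (negPf nfy) !andbF.
  have [->|//] := eqVneq z (f y).
  by rewrite fK eq_sym (negPf nfy) !andbF.
- by move: ltYn; rewrite (cardsD1 y) Yy (cardsD1 (f y) (Y :\ y)) Yfy; lia.
move=> z; rewrite !inE => /and3P[zfy zy Yz].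
rewrite fY // andbT; apply/andP; split.
  by apply: contra_neq zy => /(can_inj fK).
by apply: contra_neq zfy => <-; rewrite fK.
Qed.

Section Matching.
Variables (V : finType) (r : rel V).
Hypothesis r_sym : symmetric r.
Implicit Types (X : {set V}) (m : {ffun V -> V}).

(* A matching is encoded as the involution exchanging the ends of its edges; the
   fixed points are the vertices it misses. *)
Definition matching X m :=
  [forall v, (m (m v) == v) && ((m v != v) ==> (v \in X) && r v (m v))].

Definition missed X m := [set v in X | m v == v].

Definition maximum X m :=
  matching X m &&
  [forall m', matching X m' ==> (#|missed X m| <= #|missed X m'|)].

Lemma matchingP X m :
  reflect (involutive m /\ forall v, m v != v -> v \in X /\ r v (m v))
          (matching X m).
Proof.
apply: (iffP forallP) => [H|[mK H] v].
  split=> [v|v nv]; first by have /andP[/eqP] := H v.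
  by have /andP[_ /implyP/(_ nv)/andP] := H v.
by rewrite mK eqxx; apply/implyP=> /H[-> ->].
Qed.

Lemma maximumP X m :
  reflect (matching X m /\ forall m', matching X m' ->
             #|missed X m| <= #|missed X m'|) (maximum X m).
Proof.
apply: (iffP andP) => -[Hm H]; split=> //.
  by move=> m'; apply/implyP; apply: (forallP H).
by apply/forallP=> m'; apply/implyP/H.
Qed.

Lemma matching_id X : matching X [ffun v => v].
Proof. by apply/matchingP; split=> v; rewrite !ffunE ?eqxx. Qed.

Lemma ex_maximum X : exists m, maximum X m.
Proof.
case: (arg_minnP (fun m => #|missed X m|) (matching_id X)) => m Hm min_m.
by exists m; apply/maximumP.
Qed.

Lemma matching_in X m v : matching X m -> v \in X -> m v \in X.
Proof.
move=> /matchingP[mK H] Xv; have [->//|nv] := eqVneq (m v) v.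
by apply: (H (m v) _).1; rewrite mK eq_sym.
Qed.

Lemma odd_missed X m : matching X m -> odd #|missed X m| = odd #|X|.
Proof.
move=> Hm; have [mK _] := matchingP _ _ Hm.
by apply: odd_card_involution => // v; apply: matching_in.
Qed.

(** Otherwise the edge [uv] could be added to [m], giving a matching that misses fewer vertices. *)
Lemma missed_adj X m u v :
  maximum X m -> u \in missed X m -> v \in missed X m -> r u v -> u = v.
Proof.
move=> /maximumP[/matchingP[mK Hm] max_m].
rewrite !inE => /andP[Xu /eqP mu] /andP[Xv /eqP mv] ruv; apply/eqP/negPn/negP => nuv.
pose m' := [ffun w => if w == u then v else if w == v then u else m w].
have m'u : m' u = v by rewrite ffunE eqxx.
have m'v : m' v = u by rewrite ffunE eqxx eq_sym (negPf nuv).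
have m'w w : w != u -> w != v -> m' w = m w by rewrite ffunE => /negPf-> /negPf->.
have mne w x : m x = x -> w != x -> m w != x.
  by move=> mx; apply: contra_neq => mwx; rewrite -(mK w) mwx.
have m'M : matching X m'.
  apply/matchingP; split=> w.
    have [->|wu] := eqVneq w u; first by rewrite m'u m'v.
    have [->|wv] := eqVneq w v; first by rewrite m'v m'u.
    by rewrite (m'w w) // m'w ?mK //; apply: mne.
  have [->|wu] := eqVneq w u; first by rewrite m'u.
  have [->|wv] := eqVneq w v; first by rewrite m'v r_sym.
  by rewrite m'w //; apply: Hm.
have := max_m _ m'M; apply/negP; rewrite -ltnNge; apply: proper_card.
apply/properP; split; last first.
  by exists u; rewrite !inE ?Xu ?mu ?m'u 1?eq_sym ?(negPf nuv) ?eqxx ?andbF.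
apply/subsetP=> w; rewrite !inE => /andP[-> /=].
have [->|wu] := eqVneq w u; first by rewrite m'u eq_sym (negPf nuv).
have [->|wv] := eqVneq w v; first by rewrite m'v (negPf nuv).
by rewrite m'w.
Qed.

(* Among the maximum matchings missing [t], one that agrees with [m1] as much as
   possible works: otherwise it can be switched along an edge of [m1]. *)
Lemma gallai X m1 m2 t u v :
  maximum X m1 -> maximum X m2 -> u != v ->
  u \in missed X m1 -> v \in missed X m1 -> t \in missed X m2 ->
  exists m, [/\ maximum X m, t \in missed X m &
                (u \in missed X m) || (v \in missed X m)].
Proof.
move=> max1 max2 nuv u1 v1 t2.
pose P m := maximum X m && (t \in missed X m).
have P2 : P m2 by rewrite /P max2.
case: (arg_maxnP (fun m => #|[set w | m1 w == m w]|) P2) => m /andP[maxm tm] agree_m.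
exists m; split=> //; apply/negPn/negP; rewrite negb_or => /andP[um vm].
have [/matchingP[m1K H1] le1] := maximumP _ _ max1.
have [Mm lem] := maximumP _ _ maxm.
have [mK Hm] := matchingP _ _ Mm.
have eq1 : #|missed X m1| = #|missed X m|.
  apply/eqP; rewrite eqn_leq lem ?andbT; last by case/andP: max1.
  by apply: le1.
have [x] : exists x, x \in (missed X m :\: missed X m1) :\ t.
  apply/set0Pn; rewrite -card_gt0.
  (* Both [m] and [m1] are maximum, so they miss equally many vertices. As [u] and [v] are missed by
     [m1] only, at least two vertices are missed by [m] only, and one of them is not [t]. *)
  have : 1 < #|missed X m1 :\: missed X m|.
    apply: leq_trans (subset_leq_card (_ : [set u; v] \subset _)).
      by rewrite cards2 nuv.
    by apply/subsetP=> w /set2P[] ->; rewrite inE ?um ?vm ?u1 ?v1.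
  have := cardsID (missed X m) (missed X m1).
  have := cardsID (missed X m1) (missed X m); rewrite setIC.
  by have := cardsD1 t (missed X m :\: missed X m1); case: (_ \in _); lia.
rewrite in_setD1 in_setD => /and3P[xt xm1 xm].
have [Xx /eqP mx] : x \in X /\ m x == x by move: xm; rewrite inE => /andP.
have m1x : m1 x != x by move: xm1; rewrite inE Xx.
have rxy : r x (m1 x) by have [] := H1 x m1x.
set y := m1 x in m1x rxy.
have Xy : y \in X by apply: matching_in Xx; case/andP: max1.
have my : m y != y.
  apply/eqP=> my; have ym : y \in missed X m by rewrite inE Xy my eqxx.
  by rewrite -(missed_adj maxm xm ym rxy) eqxx in m1x.
set z := m y in my.
have zx : z != x by apply: contra_neq m1x => zx; rewrite -mx -zx mK.
have mz : m z = y by rewrite mK.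
have m1y : m1 y = x by rewrite m1K.
have [Xt /eqP mt] : t \in X /\ m t == t by move: tm; rewrite inE => /andP.
have yt : y != t by apply: contra_neq my; rewrite /z => ->.
have zt : z != t by apply: contra_neq my => zt; rewrite -[in RHS]mz zt mt -zt.
(* The edge [yz] of [m] gives way to the edge [xy] of [m1]: [z] is missed in place of [x], and [x]
   becomes a new point of agreement with [m1]. *)
pose m' := [ffun w => if w == x then y else if w == y then x
                      else if w == z then z else m w].
have m'x : m' x = y by rewrite ffunE eqxx.
have m'y : m' y = x by rewrite ffunE eqxx (negPf m1x).
have m'z : m' z = z by rewrite ffunE eqxx (negPf zx) (negPf my).
have m'w w : w != x -> w != y -> w != z -> m' w = m w.
  by rewrite ffunE => /negPf-> /negPf-> /negPf->.
have Mm' : matching X m'.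
  apply/matchingP; split=> w.
    have [->|wx] := eqVneq w x; first by rewrite m'x m'y.
    have [->|wy] := eqVneq w y; first by rewrite m'y m'x.
    have [->|wz] := eqVneq w z; first by rewrite !m'z.
    rewrite (m'w w) // m'w ?mK //.
    - by apply: contra_neq wx => mwx; rewrite -(mK w) mwx.
    - by apply: contra_neq wz => ywm; rewrite /z -ywm mK.
    - by apply: contra_neq wy => wzm; rewrite -mz -wzm mK.
  have [->|wx] := eqVneq w x; first by rewrite m'x.
  have [->|wy] := eqVneq w y; first by rewrite m'y r_sym.
  have [->|wz] := eqVneq w z; first by rewrite m'z eqxx.
  by rewrite m'w //; apply: Hm.
have missed' : missed X m' = z |: (missed X m :\ x).
  apply/setP=> w; rewrite !inE.
  have [->|wx] := eqVneq w x.
    by rewrite m'x (negPf m1x) andbF /= orbF eq_sym (negPf zx).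
  have [->|wy] := eqVneq w y.
    by rewrite m'y eq_sym (negPf m1x) (negPf my) eq_sym (negPf my) !andbF.
  have [->|wz] := eqVneq w z; last by rewrite m'w.
  by rewrite m'z eqxx andbT /=; apply: matching_in Mm Xy.
have card' : #|missed X m'| = #|missed X m|.
  rewrite missed' cardsU1 [in RHS](cardsD1 x) xm !inE mz (eq_sym y) (negPf my).
  by rewrite !andbF.
have P' : P m'.
  apply/andP; split; last first.
    by rewrite missed' !inE [t == x]eq_sym xt Xt mt eqxx orbT.
  by apply/maximumP; split=> // m'' /lem; rewrite card'.
have := agree_m _ P'; apply/negP; rewrite -ltnNge; apply: proper_card.
apply/properP; split; last first.
  by exists x; rewrite !inE ?m'x ?mx ?eqxx.
apply/subsetP=> w; rewrite !inE => /eqP m1w.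
have [->|wx] := eqVneq w x; first by rewrite m'x.
have [->|wy] := eqVneq w y; first by rewrite m'y m1y.
have [ez|wz] := eqVneq w z; last by rewrite m'w // m1w.
by move: m1w; rewrite ez mz => m1z; rewrite -m1y -m1z m1K eqxx in zx.
Qed.

Definition inseparable X u v :=
  (u == v) || ~~ [exists m, [&& maximum X m, u \in missed X m & v \in missed X m]].

Lemma inseparable_sym X : symmetric (inseparable X).
Proof.
move=> u v; rewrite /inseparable eq_sym; congr (_ || ~~ _).
by apply: eq_existsb => m; congr (_ && _); rewrite andbC.
Qed.

Variable X : {set V}.
Hypothesis all_missable :
  {in X, forall v, exists2 m, maximum X m & v \in missed X m}.

(** A maximum matching missing both [u] and [v], combined by [gallai] with one missing [t], yields
    one that misses [t] together with [u] or [v]. *)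
Lemma inseparable_trans t u v :
  t \in X -> inseparable X u t -> inseparable X t v -> inseparable X u v.
Proof.
move=> Xt iut itv; have [->//|nut] := eqVneq u t.
have [<-//|ntv] := eqVneq t v.
rewrite /inseparable; apply/norP=> -[nuv /negPn/existsP[m1 /and3P[max1 u1 v1]]].
have [m2 max2 t2] := all_missable Xt.
have [m [maxm tm]] := gallai max1 max2 nuv u1 v1 t2.
move: iut itv; rewrite /inseparable (negPf nut) (negPf ntv) /= !negb_exists.
move=> /forallP/(_ m) iut /forallP/(_ m) itv /orP[um|vm].
  by rewrite maxm um tm in iut.
by rewrite maxm vm tm in itv.
Qed.

Lemma inseparable_adj u v : u \in X -> v \in X -> r u v -> inseparable X u v.
Proof.
move=> Xu Xv ruv; apply/norP=> -[nuv /negPn/existsP[m /and3P[maxm um vm]]].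
by move/eqP: nuv; apply; apply: missed_adj maxm um vm ruv.
Qed.

Definition gallai_class u := [set v in X | inseparable X u v].

Lemma gallai_class_sub u : gallai_class u \subset X.
Proof. by apply/subsetP=> v; rewrite inE => /andP[]. Qed.

Lemma gallai_class_closed u v w :
  v \in gallai_class u -> w \in X -> r v w -> w \in gallai_class u.
Proof.
rewrite !inE => /andP[Xv uv] Xw rvw; rewrite Xw.
exact: inseparable_trans uv (inseparable_adj Xv Xw rvw).
Qed.

Lemma gallai_class_disjoint m u v w :
  maximum X m -> u \in missed X m -> v \in missed X m ->
  w \in gallai_class u -> w \in gallai_class v -> u = v.
Proof.
move=> maxm um vm; rewrite !inE => /andP[Xw uw] /andP[_ vw].
rewrite inseparable_sym in vw; have := inseparable_trans Xw uw vw.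
case/orP=> [/eqP//|/negP[]]; apply/existsP; exists m.
by rewrite maxm um vm.
Qed.

(** Adjacent vertices of [X] are inseparable, so [m] maps the class to itself; among its vertices
    [m] misses only [u], since two missed vertices are separated by [m]. *)
Lemma odd_gallai_class m u :
  maximum X m -> u \in missed X m -> odd #|gallai_class u|.
Proof.
move=> maxm um; have Mm : matching X m by case/andP: maxm.
have [mK Hm] := matchingP _ _ Mm.
rewrite -(@odd_card_involution _ m) //.
  rewrite (_ : finset _ = [set u]) ?cards1 //; apply/setP=> w.
  rewrite !inE; apply/idP/eqP=> [/andP[/andP[Xw uw] mw]|->].
    apply/esym/(gallai_class_disjoint maxm um (w := w)).
    - by rewrite inE Xw.
    - by rewrite inE Xw uw.
    - by rewrite inE Xw /inseparable eqxx.
  by move: um; rewrite inE => /andP[-> ->]; rewrite /inseparable eqxx.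
move=> w wu; have [->//|nw] := eqVneq (m w) w.
have [Xw rw] := Hm w nw.
exact: gallai_class_closed wu (matching_in Mm Xw) rw.
Qed.

End Matching.

(** * Cuts and tight perfect matchings *)

Section Cut.
Variables (V E : finType).
Implicit Types (s t : E -> V) (X Y Z : {set V}) (A M : {set E}) (e : E).

(* The graph is given by the two ends [s e], [t e] of each edge [e]: contracting a
   set of vertices then amounts to composing [s] and [t] with a map, and the edges
   that become loops belong to no cut. *)
Definition cut s t X := [set e | (s e \in X) != (t e \in X)].

Lemma cutC s t X : cut s t (~: X) = cut s t X.
Proof. by apply/setP=> e; rewrite !inE; do 2!case: (_ \in X). Qed.

Lemma cut_submodular s t A X Y :
  #|A :&: cut s t (X :&: Y)| + #|A :&: cut s t (X :|: Y)|
    <= #|A :&: cut s t X| + #|A :&: cut s t Y|.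
Proof.
rewrite !card_sum_mem -!big_split /=; apply: leq_sum => e _.
rewrite !inE; case: (e \in A) => //=.
by case: (s e \in X); case: (t e \in X); case: (s e \in Y); case: (t e \in Y).
Qed.

(** The edges between [X] and [Y] lie in both cuts and not in the cut of the union, so they
    contribute an even number. *)
Lemma odd_cutU s t X Y : [disjoint X & Y] ->
  odd #|cut s t (X :|: Y)| = odd #|cut s t X| (+) odd #|cut s t Y|.
Proof.
move=> dXY; rewrite -oddD.
have -> : #|cut s t X| + #|cut s t Y|
          = #|cut s t (X :|: Y)| + #|cut s t X :&: cut s t Y|.*2.
  rewrite -addnn !card_sum_mem -!big_split /=; apply: eq_bigr => e _.
  rewrite !inE.
  have nXY v : ~~ ((v \in X) && (v \in Y)).
    by apply/andP=> -[/(disjointFr dXY)->].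
  move: (nXY (s e)) (nXY (t e)).
  by case: (s e \in X); case: (t e \in X); case: (s e \in Y); case: (t e \in Y).
by rewrite oddD odd_double addbF.
Qed.

Lemma odd_cut s t (D : {set V}) X :
  {in D, forall v, #|cut s t [set v]| = 3} -> X \subset D ->
  odd #|cut s t X| = odd #|X|.
Proof.
move=> cubD; have [n] := ubnP #|X|; elim: n X => // n IHn X ltXn XD.
have [->|[x Xx]] := set_0Vmem X.
  by rewrite cards0 (_ : cut _ _ _ = set0) ?cards0 //; apply/setP=> e; rewrite !inE.
rewrite -(setD1K Xx) odd_cutU; last by rewrite disjoints1 !inE eqxx.
rewrite cubD ?(subsetP XD) // IHn ?cardsU1 ?oddD ?inE ?eqxx //.
  by rewrite (cardsD1 x) Xx in ltXn.
by apply: subset_trans XD; apply: subsetDl.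
Qed.

End Cut.

(** * Perfect matchings through a prescribed edge *)

Section PerfectMatching.
Variables (V E : finType) (s t : E -> V) (D : {set V}).
Hypothesis sD : forall e, s e \in D.
Hypothesis tD : forall e, t e \in D.
Hypothesis cubD : {in D, forall v, #|cut s t [set v]| = 3}.
Hypothesis cut_neq1 : forall X, #|cut s t X| != 1.
Implicit Types (u v : V) (e : E) (X : {set V}) (m : {ffun V -> V}).

Let joins u v e := (s e == u) && (t e == v) || (s e == v) && (t e == u).
Let adjacent u v := [exists e, joins u v e].

Let joinsC u v : joins u v =1 joins v u.
Proof. by move=> e; rewrite /joins orbC. Qed.

Let adjacent_sym : symmetric adjacent.
Proof. by move=> u v; apply: eq_existsb => e; rewrite joinsC. Qed.

Lemma edges_of_matching X m :
  matching adjacent X m -> missed X m = set0 -> X \subset D ->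
  exists M : {set E}, {in X, forall v, #|M :&: cut s t [set v]| = 1} /\
    {in M, forall e, s e \in X /\ t e \in X}.
Proof.
move=> Hm m0 XD; have [mK Hr] := matchingP _ _ _ Hm.
have nm v : v \in X -> m v != v.
  by move=> Xv; apply/negP=> mv; have := in_set0 v; rewrite -m0 inE Xv mv.
(* One edge has to be selected among parallel ones. As [joins] is symmetric, [pick] selects the same
   edge from either end. *)
pose M := [set e | (s e \in X) && (Some e == [pick e' | joins (s e) (m (s e)) e'])].
have MP v : v \in X -> exists e, [/\ joins v (m v) e, e \in M &
    forall e', e' \in M -> (s e' == v) || (t e' == v) -> e' = e].
  move=> Xv; have [_ /existsP[e0 e0P]] := Hr v (nm v Xv).
  case def_e: [pick e | joins v (m v) e] => [e|]; last first.
    by move: def_e; case: pickP => // /(_ e0); rewrite e0P.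
  have eP : joins v (m v) e by move: def_e; case: pickP => // e1 ? [<-].
  have defm : [pick e | joins (m v) (m (m v)) e] = Some e.
    by rewrite -def_e mK; apply: eq_pick => e1; rewrite joinsC.
  have Xmv : m v \in X by apply: matching_in Hm Xv.
  exists e; split=> //.
    rewrite inE; case/orP: (eP) => /andP[/eqP-> _];
    by rewrite ?Xv ?Xmv ?def_e ?defm eqxx.
  move=> e'; rewrite inE => /andP[Xse' /eqP e'P].
  have je' : joins (s e') (m (s e')) e'.
    by move: e'P; case: pickP => // e1 je1 [def_e1]; rewrite -def_e1 in je1.
  case/orP=> [/eqP se'|/eqP te']; first by move: e'P; rewrite se' def_e => -[].
  have : t e' = m (s e').
    by case/orP: je' => /andP[/eqP H1 /eqP H2]; rewrite H2 // -H1.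
  rewrite te' => vm; move: e'P; have -> : s e' = m v by rewrite vm mK.
  by rewrite defm => -[].
exists M; split.
  move=> v Xv; have [e [je Me eU]] := MP v Xv.
  apply/eqP/cards1P; exists e; apply/setP=> e'; rewrite 2!inE.
  apply/andP/eqP=> [[Me' ce']|->].
    apply: eU => //; move: ce'; rewrite !inE.
    by case: (s e' == v); case: (t e' == v).
  split=> //; rewrite !inE.
  by case/orP: je => /andP[/eqP-> /eqP->]; rewrite eqxx (negPf (nm v Xv)).
move=> e; rewrite inE => /andP[Xse /eqP eP].
have je : joins (s e) (m (s e)) e.
  by move: eP; case: pickP => // e1 je1 [def_e1]; rewrite -def_e1 in je1.
split=> //; have Xm := matching_in Hm Xse.
by case/orP: je => /andP[/eqP H1 /eqP H2]; rewrite H2 // -H1.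
Qed.

Section Barrier.
Variables (e0 : E) (X : {set V}).
Hypothesis e0_loopless : s e0 != t e0.
Hypothesis XD : X \subset D.
Hypothesis e0X : s e0 \notin X /\ t e0 \notin X.

(** Each vertex of [D :\: X] carries 3 edge ends. Every edge of the cut uses one of them, and [e0],
    which is not in the cut, uses two. *)
Lemma card_cut_barrier :
  #|cut s t (D :\: X)| + 2 <= 3 * #|D :\: X|.
Proof.
have -> : 3 * #|D :\: X| = \sum_(v in D :\: X) #|cut s t [set v]|.
  rewrite mulnC -sum_nat_const; apply: eq_bigr => v.
  by rewrite inE => /andP[_ /cubD->].
under [in leqRHS]eq_bigr => v _ do rewrite card_sum_mem.
rewrite exchange_big /= card_sum_mem.
rewrite (bigD1 e0) //= [leqRHS](bigD1 e0) //=.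
have [sX tX] := e0X.
have -> : (e0 \in cut s t (D :\: X)) = false by rewrite !inE !sD !tD sX tX.
have le2 : 2 <= \sum_(v in D :\: X) (e0 \in cut s t [set v]).
  rewrite (bigD1 (s e0)) /= ?inE ?sX ?sD // (bigD1 (t e0)) /=; last first.
    by rewrite !inE tX tD eq_sym.
  have nts : (t e0 == s e0) = false by rewrite eq_sym (negPf e0_loopless).
  by rewrite !inE !eqxx nts (negPf e0_loopless).
rewrite add0n addnC; apply: leq_add => //; apply: leq_sum => e _.
case ce: (e \in cut s t (D :\: X)) => //.
have [se|se] := boolP (s e \in D :\: X); have [te|te] := boolP (t e \in D :\: X).
- by move: ce; rewrite inE se te.
- rewrite (bigD1 (s e)) //= inE !in_set1 eqxx.
  by have /negPf-> : t e != s e by apply: contraNneq te => ->.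
- rewrite (bigD1 (t e)) //= inE !in_set1 eqxx.
  by have /negPf-> : s e != t e by apply: contraNneq se => ->.
by move: ce; rewrite inE (negPf se) (negPf te).
Qed.

(** The class of a missed vertex is odd, hence so is its cut, which has at least 3 edges because no
    cut has exactly one. These edges end in [D :\: X], so each has a single end in [X] and belongs
    to the cut of one class only. *)
Lemma missed_barrier m :
  {in X, forall v, exists2 m, maximum adjacent X m & v \in missed X m} ->
  maximum adjacent X m -> 3 * #|missed X m| <= #|cut s t (D :\: X)|.
Proof.
move=> missX maxm; pose K := gallai_class adjacent X.
have KX u v : v \in K u -> v \in X by apply/subsetP/gallai_class_sub.
have end_cut u e : e \in cut s t (K u) -> exists v w,
    [/\ joins v w e, v \in K u & w \notin X].
  have H v w : v \in K u -> w \notin K u -> joins v w e -> w \notin X.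
    move=> vK wK jvw; apply: contra wK => wX.
    by apply: gallai_class_closed missX _ _ _ vK wX _; last by apply/existsP; exists e.
  rewrite inE; case se: (s e \in K u); case te: (t e \in K u) => // _.
    exists (s e), (t e); rewrite /joins !eqxx; split=> //.
    by apply: H se _ _; rewrite ?te // /joins !eqxx.
  exists (t e), (s e); rewrite /joins !eqxx orbT; split=> //.
  by apply: H te _ _; rewrite ?se // /joins !eqxx orbT.
apply: (@leq_trans (\sum_(u in missed X m) #|cut s t (K u)|)).
  rewrite mulnC -sum_nat_const; apply: leq_sum => u um.
  have : odd #|cut s t (K u)|.
    rewrite (odd_cut (D := D)) //; first exact: odd_gallai_class maxm um.
    by apply: subset_trans XD; apply: gallai_class_sub.
  by have := cut_neq1 (K u); case: #|_| => [|[|[|]]].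
under eq_bigr => u _ do rewrite card_sum_mem.
rewrite exchange_big /= card_sum_mem; apply: leq_sum => e _.
apply: sum_bool_le1 => [u um /end_cut[v [w [jvw vK wX]]]|u u' um um'].
  rewrite !inE sD tD !andbT; have vX := KX _ _ vK.
  by case/orP: jvw => /andP[/eqP-> /eqP->]; rewrite vX (negPf wX).
move=> /end_cut[v [w [jvw vK wX]]] /end_cut[v' [w' [jvw' vK' wX']]].
have vv' : v = v'.
  move: wX wX' (KX _ _ vK) (KX _ _ vK').
  case/orP: jvw => /andP[/eqP<- /eqP<-]; case/orP: jvw' => /andP[/eqP<- /eqP<-] //;
  by case: (s e \in X); case: (t e \in X).
apply: (gallai_class_disjoint _ missX maxm um um' vK _) => //.
by rewrite vv'.
Qed.

End Barrier.

(* Tutte's argument on the graph without the ends of [e0]. If it has no perfect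
   matching, delete a largest set [S] such that at least [#|S| + 2] vertices are
   missed in the rest [X]. Then every vertex of [X] is missed by some maximum
   matching, so the Gallai classes of the missed vertices are odd, and at least 3
   edges leave each of them, all towards [D :\: X]; but [e0] uses up two of the
   [3 * #|D :\: X|] edge ends there. *)
Lemma perfect_matching_through e0 : s e0 != t e0 ->
  exists2 M : {set E}, e0 \in M & {in D, forall v, #|M :&: cut s t [set v]| = 1}.
Proof.
move=> e0nl; pose X0 := D :\: [set s e0; t e0].
have X0D : X0 \subset D by apply: subsetDl.
have [/existsP[m /andP[Hm /eqP m0]]|noPM] :=
  boolP [exists m, matching adjacent X0 m && (missed X0 m == set0)].
  have [M [M1 MX]] := edges_of_matching Hm m0 X0D.
  exists (e0 |: M) => [|v Dv]; first exact: setU11.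
  rewrite setIUl; have [X0v|X0v] := boolP (v \in X0).
    rewrite (_ : [set e0] :&: _ = set0) ?set0U ?M1 //.
    apply/setP=> e; rewrite !inE; case: eqP => //= ->.
    move: X0v; rewrite !inE negb_or => /andP[/andP[vs vt] _].
    by rewrite [s e0 == v]eq_sym [t e0 == v]eq_sym (negPf vs) (negPf vt).
  rewrite (_ : M :&: _ = set0) ?setU0.
    rewrite (_ : _ :&: _ = [set e0]) ?cards1 //; apply/setP=> e; rewrite !inE.
    case: eqP => //= ->; move: X0v; rewrite !inE Dv andbT negbK.
    have nts : (t e0 == s e0) = false by rewrite eq_sym (negPf e0nl).
    by case/orP=> /eqP->; rewrite eqxx ?nts ?(negPf e0nl).
  apply/setP=> e; rewrite !inE; apply/negP=> /andP[Me].
  have [Xs Xt] := MX e Me.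
  have /negPf-> : s e != v by apply: contraNneq X0v => <-.
  by have /negPf-> : t e != v by apply: contraNneq X0v => <-.
pose P (S : {set V}) := (S \subset X0) &&
  [forall m, matching adjacent (X0 :\: S) m ==> (#|S| + 2 <= #|missed (X0 :\: S) m|)].
(* The cut of [D] is empty, so [#|D|] is even. Parity then raises one missed vertex to the two that
   [P set0] requires. *)
have evenX0 : ~~ odd #|X0|.
  have := odd_cut cubD (subxx D).
  rewrite (_ : cut s t D = set0) ?cards0 => [D0|]; last first.
    by apply/setP=> e; rewrite !inE sD tD.
  have : #|D| = #|X0| + 2.
    rewrite -(cardsID [set s e0; t e0] D) addnC; congr (_ + _).
    rewrite (setIidPr _) ?cards2 ?e0nl //.
    by apply/subsetP=> v /set2P[] ->.
  by move=> D2; move: D0; rewrite D2 oddD addbF => <-.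
have P0 : P set0.
  rewrite /P sub0set cards0 setD0; apply/forallP=> m; apply/implyP=> Hm.
  have := odd_missed Hm; rewrite (negPf evenX0).
  have : missed X0 m != set0.
    by apply: contraNneq noPM => m0; apply/existsP; exists m; rewrite Hm m0 eqxx.
  by rewrite -card_gt0; case: #|_| => [|[|]].
case: (arg_maxnP (fun S : {set V} => #|S|) P0) => S /andP[SX0 PS] maxS.
set X := X0 :\: S in PS.
have defX : X = X0 :\: S by [].
have XD : X \subset D by apply: subset_trans X0D; apply: subsetDl.
clearbody X.
have [m maxm] := ex_maximum adjacent X.
have := maxm => /maximumP[Hm lem].
(* If no maximum matching of [X] misses [v], then a matching of [X :\ v] is not maximum in [X], and
   by parity it misses at least two more vertices of [X] than [m]. One of these is [v]; discounting
   it, [v |: S] satisfies [P], against the choice of [S]. *)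
have missX : {in X, forall v, exists2 m, maximum adjacent X m & v \in missed X m}.
  move=> v Xv; have [/existsP[m' /andP[]]|nv] :=
    boolP [exists m', maximum adjacent X m' && (v \in missed X m')]; first by exists m'.
  have [X0v Sv] : v \in X0 /\ v \notin S by move: Xv; rewrite defX inE => /andP[].
  have XvE : X0 :\: (v |: S) = X :\ v by rewrite defX setDDl setUC.
  have : P (v |: S).
    apply/andP; split; first by rewrite subUset sub1set X0v.
    apply/forallP=> m'; apply/implyP; rewrite XvE => Hm'.
    have [m'K Hr] := matchingP _ _ _ Hm'.
    have m'v : m' v = v by apply/eqP/negPn/negP=> /Hr[]; rewrite !inE eqxx.
    have HmX : matching adjacent X m'.
      by apply/matchingP; split=> // w /Hr[]; rewrite inE => /andP[].
    have missE : missed X m' = v |: missed (X :\ v) m'.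
      apply/setP=> w; rewrite !inE; have [->|//] := eqVneq w v.
      by rewrite m'v eqxx Xv.
    have vm' : v \in missed X m' by rewrite missE setU11.
    have ltm : #|missed X m| < #|missed X m'|.
      rewrite ltnNge; apply: contra nv => lem'; apply/existsP; exists m'.
      rewrite vm' andbT; apply/maximumP; split=> // m'' /lem.
      exact: leq_trans.
    have := forallP PS m; rewrite Hm /=.
    have : odd #|missed X m| = odd #|missed X m'|.
      by rewrite (odd_missed Hm) (odd_missed HmX).
    move: ltm; rewrite missE !cardsU1 Sv !inE eqxx /=.
    move: #|S| #|missed X m| #|missed _ _| => a b c; clear; lia.
  by move/maxS; rewrite /= cardsU1 Sv add1n ltnn.
have e0X : s e0 \notin X /\ t e0 \notin X by rewrite defX !inE !eqxx orbT /= !andbF.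
have := missed_barrier XD missX maxm.
have := card_cut_barrier e0nl e0X.
have := forallP PS m; rewrite Hm /=.
(* The bounds combine to [3 * (#|S| + 2) + 2 <= 3 * (#|S| + 2)], which is absurd. *)
have -> : #|D :\: X| = #|S| + 2; last first.
  by move: #|S| #|missed X m| #|cut _ _ _| => a b c; clear; lia.
have -> : D :\: X = S :|: [set s e0; t e0]; rewrite ?defX.
  apply/setP=> v; rewrite !inE; have := subsetP SX0 v; rewrite !inE.
  case: (v \in S) => //=.
    by move=> /(_ isT)/andP[_ ->].
  move=> _; case vv: ((v == _) || (v == _)) => /=; last by rewrite andNb.
  by case/orP: vv => /eqP->; rewrite ?sD ?tD.
rewrite cardsU cards2 e0nl (_ : _ :&: _ = set0) ?cards0 ?subn0 //.
apply/setP=> v; rewrite in_setI in_set0; apply/andP=> -[/(subsetP SX0)].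
by rewrite inE => /andP[/negPf->].
Qed.

End PerfectMatching.

(** * Perfect matchings that meet every 3-edge cut exactly once *)

Section TightMatching.
Variables (V E : finType).
Implicit Types (s t : E -> V) (D X Y Z : {set V}) (M : {set E}) (e : E).

(** In a cubic graph the singletons have 3-edge cuts, so tightness at every [Z] includes being a
    perfect matching. *)
Definition tight s t M Z := (#|cut s t Z| == 3) ==> (#|M :&: cut s t Z| == 1).

Lemma tightP s t M Z :
  reflect (#|cut s t Z| = 3 -> #|M :&: cut s t Z| = 1) (tight s t M Z).
Proof.
by apply: (iffP implyP) => H; [move/eqP/H/eqP | move/eqP/H/eqP].
Qed.

(* [D] contains the vertices of the graph; the other elements of [V] are those
   lost in contractions. *)
Definition cubic_on s t D :=
  [/\ forall e, (s e \in D) && (t e \in D),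
      {in D, forall v, #|cut s t [set v]| = 3} & forall X, #|cut s t X| != 1].

Lemma cut_setI s t D Z :
  (forall e, (s e \in D) && (t e \in D)) -> cut s t (Z :&: D) = cut s t Z.
Proof.
by move=> stD; apply/setP=> e; have /andP[sD tD] := stD e; rewrite !inE sD tD !andbT.
Qed.

Definition contract X (x v : V) := if v \in X then x else v.

Lemma cut_contract s t X x Z :
  cut (contract X x \o s) (contract X x \o t) Z = cut s t (contract X x @^-1: Z).
Proof. by apply/setP=> e; rewrite !inE. Qed.

Lemma preim_contract X x Z : [disjoint Z & X] -> x \in X -> contract X x @^-1: Z = Z.
Proof.
move=> dZX Xx; apply/setP=> v; rewrite !inE /contract; case: ifP => // Xv.
by rewrite (disjointFl dZX Xv) (disjointFl dZX Xx).
Qed.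

Lemma preim_contract1 X x : x \in X -> contract X x @^-1: [set x] = X.
Proof.
move=> Xx; apply/setP=> v; rewrite !inE /contract; case: ifP => [_|Xv].
  by rewrite eqxx.
by apply: contraFF Xv => /eqP->.
Qed.

Lemma cubic_on_contract s t D X x : cubic_on s t D -> x \in X ->
  #|cut s t X| = 3 ->
  cubic_on (contract X x \o s) (contract X x \o t) (x |: (D :\: X)).
Proof.
move=> [stD cubD neq1] Xx X3; split=> [e|v|Z]; last by rewrite cut_contract.
  have /andP[sD tD] := stD e; rewrite !inE /= /contract.
  by case: ifP => [_|->]; case: ifP => [_|->]; rewrite ?eqxx ?sD ?tD ?orbT.
rewrite cut_contract => /setU1P[->|/setDP[Dv Xv]]; first by rewrite preim_contract1.
by rewrite preim_contract ?disjoints1 //; apply: cubD.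
Qed.

(** Odd cuts have at least 3 edges, so submodularity forces exactly 3 for [X :&: Z] and [X :|: Z].
    Both cuts, and that of [X], meet [M] once. Submodularity counted in [M] then gives at least one
    edge of [M] in the cut of [Z], and counted in [~: M] at most one. *)
Lemma tight_uncross s t M X Z :
  (forall X, #|cut s t X| != 1) ->
  #|cut s t X| = 3 -> #|cut s t Z| = 3 -> odd #|cut s t (X :&: Z)| ->
  (forall W : {set V}, W \subset X -> tight s t M W) ->
  (forall W : {set V}, X \subset W -> tight s t M W) ->
  #|M :&: cut s t Z| = 1.
Proof.
move=> neq1 X3 Z3 oddI tin tout.
have ge3 W : odd #|cut s t W| -> 3 <= #|cut s t W|.
  by have := neq1 W; case: #|_| => [|[|[|]]].
have oddU : odd #|cut s t (X :|: Z)|.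
  have dXZ : [disjoint X & Z :\: X] by rewrite -setI_eq0 setIDA setDIl setDv set0I.
  have dI : [disjoint X :&: Z & Z :\: X].
    by apply: disjointWl dXZ; apply: subsetIl.
  have := odd_cutU s t dXZ; have := odd_cutU s t dI.
  rewrite (_ : X :&: Z :|: _ = Z) ?Z3 ?X3 ?oddI; last by rewrite setIC setID.
  by rewrite setDE setUIr setUCr setIT => <-.
have := cut_submodular s t setT X Z; rewrite !setTI X3 Z3.
move: (ge3 _ oddI) (ge3 _ oddU) => geI geU le6.
have I3 : #|cut s t (X :&: Z)| = 3 by lia.
have U3 : #|cut s t (X :|: Z)| = 3 by lia.
have /tightP/(_ I3) MI := tin _ (subsetIl X Z).
have /tightP/(_ U3) MU := tout _ (subsetUl X Z).
have /tightP/(_ X3) MX := tin _ (subxx X).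
have := cut_submodular s t M X Z; have := cut_submodular s t (~: M) X Z.
have C W : #|~: M :&: cut s t W| = #|cut s t W| - #|M :&: cut s t W|.
  by rewrite -(cardsID M (cut s t W)) setDE ![_ :&: cut s t W]setIC addKn.
rewrite !C MI MU MX I3 U3 X3 Z3; lia.
Qed.

(** Subsets of either side inherit tightness, and so do supersets by complementation. Any other
    3-edge cut [W] is the disjoint union of its traces on the two sides; one trace has an odd cut,
    and [W] is uncrossed with that side. *)
Lemma glue_matchings s t D X M1 M2 : cubic_on s t D ->
  X \subset D -> #|cut s t X| = 3 ->
  M1 :&: cut s t X = M2 :&: cut s t X ->
  (forall Z : {set V}, Z \subset X -> tight s t M1 Z) ->
  (forall Z : {set V}, Z \subset D :\: X -> tight s t M2 Z) ->
  forall Z, tight s t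
    [set e | if (s e \in X) || (t e \in X) then e \in M1 else e \in M2] Z.
Proof.
move=> [stD cubD neq1] XD X3 M12 t1 t2; set M := [set e | _].
have cD Z : cut s t Z = cut s t (Z :&: D) by rewrite (cut_setI _ stD).
have tX (Z : {set V}) : Z \subset X -> tight s t M Z.
  move=> ZX; have := t1 Z ZX; rewrite /tight (_ : M :&: _ = M1 :&: cut s t Z) //.
  apply/setP=> e; rewrite !inE; have := subsetP ZX (s e); have := subsetP ZX (t e).
  case: (s e \in X) => //=; case: (t e \in X) => //=.
  case: (s e \in Z) => [_ /(_ isT)//|].
  by case: (t e \in Z) => [/(_ isT)//|]; rewrite !andbF.
have tY (Z : {set V}) : Z \subset D :\: X -> tight s t M Z.
  move=> ZX; have := t2 Z ZX; rewrite /tight (_ : M :&: _ = M2 :&: cut s t Z) //.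
  apply/setP=> e; have /setP/(_ e) := M12; rewrite !inE.
  have := subsetP ZX (s e); have := subsetP ZX (t e); rewrite !inE.
  case: (s e \in X) => //=; case: (t e \in X) => //=;
  case: (s e \in Z) => //=; case: (t e \in Z) => //=; rewrite ?andbT ?andbF //;
  by do ?[move=> /(_ isT)//| move=> _].
have cY : cut s t (D :\: X) = cut s t X by rewrite setDE setIC -cD cutC.
have dXY : [disjoint X & D :\: X] by rewrite -setI_eq0 setIDA setDIl setDv set0I.
move=> Z; suff tD (W : {set V}) : W \subset D -> tight s t M W.
  by rewrite /tight cD; apply: tD; apply: subsetIr.
move=> WD; apply/tightP=> W3.
have UD : X :|: D :\: X = D by rewrite setDE setUIr setUCr setIT (setUidPr XD).
have dW : [disjoint X :&: W & (D :\: X) :&: W].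
  by apply: disjointWl (subsetIl _ _) (disjointWr (subsetIl _ _) dXY).
have := odd_cutU s t dW; rewrite -setIUl UD (setIidPr WD) W3 => /esym oddW.
have outP (A B : {set V}) : D :\: A \subset B ->
    (forall Z : {set V}, Z \subset B -> tight s t M Z) ->
    forall Z : {set V}, A \subset Z -> tight s t M Z.
  move=> AB tB C AC; rewrite /tight -cutC cD; apply: tB; apply: subset_trans AB.
  by rewrite setIC -setDE setDS.
have [oX|oX] := boolP (odd #|cut s t (X :&: W)|).
  by apply: (tight_uncross neq1 X3 W3 oX tX); apply: outP tY.
rewrite (negPf oX) /= in oddW.
apply: (tight_uncross neq1 _ W3 oddW tY); first by rewrite cY.
apply: outP tX; rewrite setDDr setDv set0U; exact: subsetIr.
Qed.

(** Induction on [#|D|]. The side containing an end of [e0] is treated first; its matching uses one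
    edge [f] of the cut, and [f] is then prescribed on the other side. *)
Theorem tight_perfect_matching s t D e0 :
  cubic_on s t D -> s e0 != t e0 ->
  exists2 M : {set E}, e0 \in M & forall Z, tight s t M Z.
Proof.
have [n] := ubnP #|D|; elim: n s t D e0 => // n IHn s t D e0 ltDn cubG e0nl.
have [stD cubD neq1] := cubG.
have cD Z : cut s t Z = cut s t (Z :&: D) by rewrite (cut_setI _ stD).
have [|noX] := boolP [exists X : {set V},
  [&& X \subset D, #|cut s t X| == 3, 1 < #|X| & 1 < #|D :\: X|]]; last first.
  have sD e : s e \in D by case/andP: (stD e).
  have tD e : t e \in D by case/andP: (stD e).
  have [M Me0 M1] := perfect_matching_through sD tD cubD neq1 e0nl.
  exists M => // Z; apply/tightP; rewrite cD; set X := Z :&: D => X3.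
  have XD : X \subset D by apply: subsetIr.
  have small (Y : {set V}) : Y \subset D -> cut s t Y = cut s t X ->
      #|Y| <= 1 -> #|M :&: cut s t Y| = 1.
    move=> YD Y3; case cY: #|Y| => [|[|]] // _.
      move/eqP: cY Y3; rewrite cards_eq0 => /eqP-> X0.
      move: X3; rewrite -X0 (_ : cut s t set0 = set0) ?cards0 //.
      by apply/setP=> e; rewrite !inE.
    move/eqP/cards1P: cY YD => [v ->]; rewrite sub1set; exact: M1.
  move: noX; rewrite negb_exists => /forallP/(_ X).
  rewrite XD X3 eqxx /= negb_and -!leqNgt.
  case/orP=> [|leY]; first exact: small.
  have cY : cut s t (D :\: X) = cut s t X by rewrite setDE setIC -cD cutC.
  by rewrite -cY; apply: small; rewrite ?subsetDl.
case/existsP=> X /and4P[XD /eqP X3 gtX gtY].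
set Y := D :\: X in gtY.
have cY : cut s t Y = cut s t X by rewrite /Y setDE setIC -cD cutC.
(* Contract [B] to one of its vertices [b]. Since [B] has at least two vertices the graph shrinks,
   and since [e] has an end in [A] it does not become a loop. Subsets of [A] keep their cuts. *)
have half (A B : {set V}) e : A \subset D -> B = D :\: A -> #|cut s t A| = 3 ->
    #|cut s t B| = 3 -> 1 < #|B| ->
    s e != t e -> (s e \in A) || (t e \in A) ->
    exists2 M : {set E}, e \in M & forall Z : {set V}, Z \subset A -> tight s t M Z.
  move=> AD defB A3 B3 gtB enl eA.
  have [b Bb] : exists b, b \in B by apply/set0Pn; rewrite -card_gt0 ltnW.
  have DB : D :\: B = A by rewrite defB setDDr setDv set0U (setIidPr AD).
  have dBA (Z : {set V}) : Z \subset A -> [disjoint Z & B].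
    move=> ZA; apply: disjointWl ZA _.
    by rewrite defB -setI_eq0 setIDA setDIl setDv set0I.
  have [] := IHn (contract B b \o s) (contract B b \o t) (b |: (D :\: B)) e.
  - have := cardsD1 b (b |: (D :\: B)); rewrite setU11.
    have := cardsID B D; rewrite (setIidPr (_ : B \subset D)) ?defB ?subsetDl // -defB.
    have : #|(b |: D :\: B) :\ b| <= #|D :\: B|.
      by apply: subset_leq_card; rewrite subDset.
    by move: ltDn gtB; rewrite /=; lia.
  - exact: cubic_on_contract.
  - have Bst v : v \in D -> (v \in B) = (v \notin A).
      by rewrite defB inE => ->; rewrite andbT.
    have /andP[sD tD] := stD e; rewrite /= /contract !Bst //.
    have nbA v : v \in A -> v != b.
      by move=> Av; apply: contraTneq Bb => <-; rewrite defB inE Av.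
    case: (boolP (s e \in A)) eA => [sA|sA] /=;
      case: (boolP (t e \in A)) => [tA|tA] //= _.
      exact: nbA.
    by rewrite eq_sym nbA.
  move=> M Me tM; exists M => // Z ZA; have := tM Z; rewrite /tight cut_contract.
  by rewrite preim_contract // dBA.
have cut_nl e : e \in cut s t X -> s e != t e.
  by rewrite inE; apply: contraNneq => ->.
have cut1 (M : {set E}) f Z : #|M :&: cut s t Z| = 1 ->
    f \in M -> f \in cut s t Z -> M :&: cut s t Z = [set f].
  move=> /eqP/cards1P[g Mg] Mf Zf; rewrite Mg; congr [set _].
  by apply/esym/set1P; rewrite -Mg inE Mf.
have DYX : D :\: Y = X by rewrite /Y setDDr setDv set0U (setIidPr XD).
have Y3 : #|cut s t Y| = 3 by rewrite cY.
have halfX e := half X Y e XD (erefl _) X3 Y3 gtY.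
have halfY e := half Y X e (subsetDl _ _) (esym DYX) Y3 X3 gtX.
have touch e : e \in cut s t X ->
    ((s e \in X) || (t e \in X)) && ((s e \in Y) || (t e \in Y)).
  have /andP[sD tD] := stD e; rewrite !inE sD tD.
  by case: (s e \in X); case: (t e \in X).
have [e0X|e0X] := boolP ((s e0 \in X) || (t e0 \in X)).
  have [M1 Me0 t1] := halfX e0 e0nl e0X.
  have /tightP/(_ X3) M1X := t1 X (subxx X).
  have /eqP/cards1P[f defM1] := M1X.
  have /setIP[M1f Xf] : f \in M1 :&: cut s t X by rewrite defM1 set11.
  have /andP[_ fY] := touch f Xf.
  have [M2 M2f t2] := halfY f (cut_nl f Xf) fY.
  exists [set e | if (s e \in X) || (t e \in X) then e \in M1 else e \in M2].
    by rewrite inE e0X.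
  apply: (glue_matchings cubG XD X3 _ t1 t2).
  rewrite defM1 (cut1 M2 f) //.
  by have /tightP := t2 Y (subxx Y); rewrite cY => /(_ X3).
have e0Y : (s e0 \in Y) || (t e0 \in Y).
  by have /andP[sD tD] := stD e0; rewrite !inE sD tD; move: e0X; case: (_ \in X).
have [M2 Me0 t2] := halfY e0 e0nl e0Y.
have M2X : #|M2 :&: cut s t X| = 1.
  by have /tightP := t2 Y (subxx Y); rewrite cY => /(_ X3).
have /eqP/cards1P[f defM2] := M2X.
have /setIP[M2f Xf] : f \in M2 :&: cut s t X by rewrite defM2 set11.
have /andP[fX _] := touch f Xf.
have [M1 M1f t1] := halfX f (cut_nl f Xf) fX.
exists [set e | if (s e \in X) || (t e \in X) then e \in M1 else e \in M2].
  by rewrite inE (negPf e0X).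
apply: (glue_matchings cubG XD X3 _ t1 t2).
rewrite defM2 (cut1 M1 f) //.
by have /tightP := t1 X (subxx X) => /(_ X3).
Qed.

End TightMatching.

(** * Packing spanning sets of a linear matroid *)

Section Packing.
Variables (K : fieldType) (vT : vectType K) (E : finType) (d : E -> vT).
Variable U : {vspace vT}.
Implicit Types (A B C R : {set E}) (e a : E).

(* Span and independence in the matroid of [d], after contraction of [U]. *)
Definition relspan A := (U + \sum_(e in A) <[d e]>)%VS.
Definition relfree A := \dim (relspan A) == \dim U + #|A|.

Lemma sub_relspan A W :
  (relspan A <= W)%VS = (U <= W)%VS && [forall e in A, d e \in W].
Proof.
rewrite subv_add; congr (_ && _); apply/subv_sumP/forall_inP => H e eA.
  by rewrite memvE; apply: H.
by rewrite -memvE; apply: H.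
Qed.

Lemma subU_relspan A : (U <= relspan A)%VS.
Proof. exact: addvSl. Qed.

Lemma mem_relspan A e : e \in A -> d e \in relspan A.
Proof.
move=> eA; apply: subv_trans (addvSr _ _).
exact: (sumv_sup e).
Qed.

Lemma relspanS A B : A \subset B -> (relspan A <= relspan B)%VS.
Proof.
move=> /subsetP AB; rewrite sub_relspan subU_relspan; apply/forall_inP=> e /AB.
exact: mem_relspan.
Qed.

Lemma relspan_coef A v : v \in relspan A ->
  exists c : E -> K, (v - \sum_(e in A) c e *: d e)%R \in U.
Proof.
case/memv_addP=> u Uu [_ /memv_sumP[w Hw ->] ->].
have Hc e : exists c, e \in A -> w e = (c *: d e)%R.
  have [eA|] := boolP (e \in A); last by exists 0%R.
  by have /vlineP[c ->] := Hw e eA; exists c.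
have [c Hc'] := fin_all_exists Hc.
exists c; rewrite (eq_bigr _ Hc') addrK //.
Qed.

Lemma dim_relspanU A B : \dim (relspan (A :|: B)) <= \dim (relspan A) + #|B|.
Proof.
have: (relspan (A :|: B) <= relspan A + \sum_(e in B) <[d e]>)%VS.
  rewrite sub_relspan; apply/andP; split.
    exact: subv_trans (subU_relspan A) (addvSl _ _).
  apply/forall_inP=> e /setUP[/mem_relspan|eB].
    by apply/subvP/addvSl.
  by rewrite memvE; apply: subv_trans (addvSr _ _); apply: (sumv_sup e).
move/dimvS/leq_trans; apply; apply: leq_trans (dimv_add_leqif _ _) _.
rewrite leq_add2l; apply: leq_trans (dimv_leq_sum _ _ _) _.
by rewrite -sum1_card; apply: leq_sum => e _; rewrite dim_vline leq_b1.
Qed.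

Lemma relspan0 : relspan set0 = U.
Proof. by rewrite /relspan big_set0 addv0. Qed.

Lemma dim_relspan A : \dim (relspan A) <= \dim U + #|A|.
Proof. by have := dim_relspanU set0 A; rewrite set0U relspan0. Qed.

Lemma relfreeE A : relfree A = (\dim U + #|A| <= \dim (relspan A)).
Proof. by rewrite /relfree eqn_leq dim_relspan. Qed.

Lemma relfreeS A B : A \subset B -> relfree B -> relfree A.
Proof.
move=> AB; rewrite !relfreeE; have := dim_relspanU A (B :\: A).
rewrite -(cardsID A B) (setIidPr AB) setDE setUIr setUCr setIT (setUidPr AB).
move: (\dim _) (\dim _) (\dim _) #|A| #|_ :&: _| => a b c x y; clear; lia.
Qed.

Lemma relfreeU1 A e : relfree A -> d e \notin relspan A -> relfree (e |: A).
Proof.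
move=> freeA de; have eA : e \notin A by apply: contra de; apply: mem_relspan.
rewrite relfreeE cardsU1 eA add1n addnS -(eqP freeA) ltn_neqAle.
rewrite dimvS ?relspanS ?subsetUr // andbT.
rewrite (dimv_leqif_sup (relspanS (subsetUr [set e] A))).
by apply: contra de => /subvP; apply; apply: mem_relspan; apply: setU11.
Qed.

(** [C] is the support of an expression of [d e] over [A]: with [e] it forms a circuit, up to
    elements of [U], so any element of [C] can be recovered from [e] and the others. *)
Lemma relspan_exchange A e : e \notin A -> relfree A -> d e \in relspan A ->
  exists C, [/\ C \subset A, d e \in relspan C &
    {in C, forall a, relfree (e |: A :\ a)}].
Proof.
move=> eA freeA /relspan_coef[c]; set u := (_ - _)%R => Uu.
have de : d e = (u + \sum_(a in A) c a *: d a)%R by rewrite subrK.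
exists [set a in A | c a != 0%R]; split.
- by apply/subsetP=> a; rewrite inE => /andP[].
- rewrite de memvD //; first by apply: subvP (subU_relspan _) _ Uu.
  apply: memv_suml => a Aa; have [->|ca] := eqVneq (c a) 0%R.
    by rewrite scale0r mem0v.
  by apply/memvZ/mem_relspan; rewrite inE Aa.
move=> a; rewrite inE => /andP[Aa ca].
have card_x : #|e |: A :\ a| = #|A|.
  by rewrite cardsU1 !inE (negPf eA) andbF (cardsD1 a A) Aa.
rewrite relfreeE card_x -(eqP freeA); apply: dimvS.
rewrite sub_relspan subU_relspan; apply/forall_inP=> b Ab.
have [->|ba] := eqVneq b a; last first.
  by apply: mem_relspan; rewrite !inE ba Ab orbT.
move: de; rewrite (bigD1 a) //= => de.
have -> : d a = ((c a)^-1 *: (d e - (u + \sum_(i in A | i != a) c i *: d i)))%R.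
  by rewrite de addrCA addrK scalerA mulVf // scale1r.
apply/memvZ/memvB; first by apply/mem_relspan/setU11.
apply: memvD; first by apply: subvP (subU_relspan _) _ Uu.
apply: memv_suml => i /andP[Ai ia].
by apply/memvZ/mem_relspan; rewrite !inE ia Ai orbT.
Qed.

Variable I : finType.
Implicit Types (p q : {ffun E -> option I}) (i j : I).

(* Disjoint sets indexed by [I], given by the map sending an element to the index
   of the set that contains it. *)
Definition part p i := [set e | p e == Some i].
Definition covered p := [set e | isSome (p e)].
Definition free_parts p := [forall i, relfree (part p i)].

Let step p q := [exists e, exists i, exists a,
  [&& p e == None, p a == Some i, free_parts q &
      q == [ffun x => if x == e then Some i else if x == a then None else p x]]].

(* [R] collects the elements left uncovered by some packing reachable from an
   optimal one by exchanges; along exchanges the span of the intersection of each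
   part with [R] does not change. *)
Lemma free_parts_exchange : exists p R,
  [/\ free_parts p, forall e, p e = None -> e \in R &
      forall i, (relspan R <= relspan (part p i :&: R))%VS].
Proof.
have free0 : free_parts [ffun=> None].
  apply/forallP=> i; rewrite relfreeE (_ : part _ i = set0) ?relspan0 ?cards0 ?addn0 //.
  by apply/setP=> e; rewrite !inE ffunE.
case: (arg_maxnP (fun p => #|covered p|) free0) => p0 freep0 maxp0.
pose R := [set e | [exists p, connect step p0 p && (p e == None)]].
have RE e : (e \in R) = [exists p, connect step p0 p && (p e == None)] by rewrite inE.
clearbody R.
(* An exchange covers as many elements as before, so all reachable packings are optimal too. *)
have reach p : connect step p0 p -> free_parts p /\ #|covered p| = #|covered p0|.
  move: p; apply: connect_ind => // p q _ [freep <-].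
  move=> /existsP[e /existsP[i /existsP[a /and4P[/eqP pe /eqP pa freeq /eqP defq]]]].
  split=> //; rewrite (_ : covered q = e |: covered p :\ a).
    by rewrite cardsU1 !inE pe andbF [in RHS](cardsD1 a) !inE pa.
  apply/setP=> x; rewrite defq !inE ffunE.
  by have [//|xe] := eqVneq x e; have [//|xa] := eqVneq x a.
(* Otherwise [e] could be added to part [i], against optimality. *)
have mem_span p e i : connect step p0 p -> p e = None -> d e \in relspan (part p i).
  move=> /reach[freep cardp] pe; apply/negPn/negP=> de.
  pose q := [ffun x => if x == e then Some i else p x].
  have freeq : free_parts q.
    apply/forallP=> j; have [->|ji] := eqVneq j i.
      rewrite (_ : part q i = e |: part p i); last first.
        by apply/setP=> x; rewrite !inE ffunE; case: (x == e); rewrite ?eqxx.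
      by apply: relfreeU1 de; apply: (forallP freep).
    rewrite (_ : part q j = part p j); first exact: (forallP freep).
    apply/setP=> x; rewrite !inE ffunE; have [->|//] := eqVneq x e.
    by rewrite pe; apply/eqP=> -[] ij; rewrite ij eqxx in ji.
  have := maxp0 q freeq; rewrite /= -cardp.
  rewrite (_ : covered q = e |: covered p) ?cardsU1 ?inE ?pe ?ltnn //.
  by apply/setP=> x; rewrite !inE ffunE; case: (x == e).
(* Every element of the circuit of [e] can be exchanged for [e], which leaves it uncovered; so the
   circuit lies in [R]. *)
have span_R p e i : connect step p0 p -> p e = None -> d e \in relspan (part p i :&: R).
  move=> p0p pe; have [freep _] := reach p p0p.
  have epi : e \notin part p i by rewrite inE pe.
  have [C [Cp dC freeC]] :=
    relspan_exchange epi (forallP freep i) (mem_span p e i p0p pe).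
  apply: subvP (d e) dC; apply: relspanS; rewrite subsetI Cp /=.
  apply/subsetP=> a Ca; rewrite RE; apply/existsP.
  pose q := [ffun x => if x == e then Some i else if x == a then None else p x].
  have pa : p a = Some i by have := subsetP Cp a Ca; rewrite inE => /eqP.
  have ae : a != e by apply: contra_eq_neq pe => <-; rewrite pa.
  exists q; rewrite ffunE (negPf ae) eqxx andbT; apply: connect_trans p0p (connect1 _).
  apply/existsP; exists e; apply/existsP; exists i; apply/existsP; exists a.
  rewrite pe pa !eqxx /= andbT; apply/forallP=> j.
  have [->|ji] := eqVneq j i.
    rewrite (_ : part q i = e |: part p i :\ a) ?freeC //.
    apply/setP=> x; rewrite !inE ffunE.
    by have [|xe] := eqVneq x e; rewrite ?eqxx //=; have [|//] := eqVneq x a.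
  rewrite (_ : part q j = part p j); first exact: (forallP freep).
  have Sij : (Some i == Some j) = false by apply/eqP=> -[] ij; rewrite ij eqxx in ji.
  apply/setP=> x; rewrite !inE ffunE.
  have [->|xe] := eqVneq x e; first by rewrite pe Sij.
  by have [->|//] := eqVneq x a; rewrite pa Sij.
(* The new set is spanned by the old one thanks to [span_R], and both are free of the same size. *)
have invar p : connect step p0 p ->
    forall i, relspan (part p i :&: R) = relspan (part p0 i :&: R).
  move: p; apply: connect_ind => // p q p0p IH pq i; rewrite -IH.
  have p0q : connect step p0 q by apply: connect_trans p0p (connect1 pq).
  have /existsP[e /existsP[j /existsP[a /and4P[/eqP pe /eqP pa freeq /eqP defq]]]] := pq.
  have [freep _] := reach p p0p.
  have Re : e \in R by rewrite RE; apply/existsP; exists p; rewrite p0p pe.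
  have ae : a != e by apply: contra_eq_neq pe => <-; rewrite pa.
  have Ra : a \in R.
    by rewrite RE; apply/existsP; exists q; rewrite p0q defq ffunE (negPf ae) eqxx.
  have [defi|ij] := eqVneq i j; last first.
    have Sij : (Some j == Some i) = false.
      by apply/eqP=> -[] ji; rewrite ji eqxx in ij.
    rewrite (_ : part q i = part p i) //.
    apply/setP=> x; rewrite defq !inE ffunE.
    have [->|xe] := eqVneq x e; first by rewrite pe Sij.
    by have [->|//] := eqVneq x a; rewrite pa Sij.
  rewrite defi.
  have defqR : part q j :&: R = e |: (part p j :&: R) :\ a.
    apply/setP=> x; rewrite defq !inE ffunE.
    have [->|xe] := eqVneq x e; first by rewrite eqxx Re.
    by have [->|xa] := eqVneq x a; rewrite ?andbF.
  have cardq : #|part q j :&: R| = #|part p j :&: R|.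
    rewrite defqR cardsU1 [in RHS](cardsD1 a) !inE pe pa Ra !andbF.
    by rewrite eqxx.
  apply/eqP; rewrite eqEdim.
  rewrite (eqP (relfreeS (subsetIl _ R) (forallP freep j))).
  rewrite (eqP (relfreeS (subsetIl _ R) (forallP freeq j))) cardq leqnn andbT.
  rewrite defqR sub_relspan subU_relspan; apply/forall_inP=> x /setU1P[->|/setD1P[_]].
    exact: span_R.
  exact: mem_relspan.
exists p0, R; split=> // [e pe|i].
  by rewrite RE; apply/existsP; exists p0; rewrite connect0 pe.
rewrite sub_relspan subU_relspan; apply/forall_inP=> e; rewrite RE.
move=> /existsP[p /andP[p0p /eqP pe]].
by rewrite -(invar p p0p); apply: span_R.
Qed.

(** All elements outside [R] are covered, and part [i] has dimension [\dim (relspan R)] plus the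
    number of its elements outside [R]. Under the hypothesis the dimensions add up to the largest
    possible total, so every part attains the maximum. *)
Theorem spanning_packing :
  (forall R, #|I| * \dim (relspan setT) <= #|I| * \dim (relspan R) + #|~: R|) ->
  exists p, forall i, relspan (part p i) = relspan setT.
Proof.
move=> cond; have [p [R [freep pR spanR]]] := free_parts_exchange.
exists p; pose f i := \dim (relspan (part p i)).
have fE i : f i = \dim (relspan R) + #|part p i :\: R|.
  rewrite /f (eqP (forallP freep i)) -(cardsID R) addnA; congr (_ + _).
  rewrite -(eqP (relfreeS (subsetIl _ R) (forallP freep i))).
  apply: anti_leq; rewrite dimvS ?relspanS ?subsetIr //=.
  exact/dimvS/spanR.
have le_f i : f i <= \dim (relspan setT) by apply/dimvS/relspanS/subsetT.
have sum_f : #|I| * \dim (relspan setT) <= \sum_i f i.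
  rewrite (eq_bigr _ (fun i _ => fE i)) big_split /= sum_nat_const.
  apply: leq_trans (cond R) _; rewrite leq_add2l.
  have -> : \sum_i #|part p i :\: R| = #|\bigcup_i (part p i :\: R)|.
    rewrite -[RHS]sum1_card partition_disjoint_bigcup /=.
      by apply: eq_bigr => i _; rewrite sum1_card.
    move=> i j ij; rewrite -setI_eq0; apply/eqP/setP=> e; rewrite !inE.
    apply/negP=> /andP[/andP[_ /eqP->] /andP[_ /eqP[ji]]].
    by rewrite ji eqxx in ij.
  apply: subset_leq_card; apply/subsetP=> e; rewrite inE => eR.
  case pe: (p e) => [i|]; last by rewrite pR in eR.
  by apply/bigcupP; exists i => //; rewrite !inE eR pe eqxx.
move=> i; apply/eqP; rewrite eqEdim relspanS ?subsetT //=.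
move: sum_f; rewrite -sum_nat_const (bigD1 i) //= [leqRHS](bigD1 i) //=.
rewrite leqNgt => le; rewrite leqNgt; apply: contra le => lt.
rewrite -addSn; apply: leq_add => //; exact: leq_sum.
Qed.

End Packing.

(** * Flows in the Klein group *)

Section Flow.
Variables (V E : finType) (s t : E -> V).
Local Notation cut := (cut s t).
Implicit Types (X : {set V}) (N A R : {set E}) (e : E).

(** Conservation is required across all cuts. There are no signs, as the values used lie in groups
    of exponent 2. *)
Definition flow (K : zmodType) (y : E -> K) :=
  forall X, (\sum_(e in cut X) y e)%R = 0%R.

Definition ind (v : V) : 'rV['F_2]_#|V| := (\row_j (enum_val j == v)%:R)%R.
Definition boundary e := (ind (s e) - ind (t e))%R.

(** The coordinates of [boundary e] indexed by [X] add up to 1 modulo 2 when [e] is in the cut of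
    [X], and to 0 otherwise. *)
Lemma flow_boundary (y : E -> 'F_2) :
  (\sum_e y e *: boundary e)%R = 0%R -> flow y.
Proof.
move=> y0 X.
have : (\sum_(v in X) (\sum_e y e *: boundary e) 0 (enum_rank v))%R = 0%R :> 'F_2.
  by rewrite y0; apply: big1 => v _; rewrite mxE.
rewrite (eq_bigr (fun v => \sum_e y e * ((v == s e)%:R - (v == t e)%:R))%R)
  => [y0X|v _]; last first.
  by rewrite summxE; apply: eq_bigr => e _; rewrite !mxE enum_rankK.
rewrite -[RHS]y0X [RHS]exchange_big [LHS]big_mkcond; apply: eq_bigr => e _ /=.
rewrite -mulr_sumr.
have sum_mem x : (\sum_(v in X) (v == x)%:R = (x \in X)%:R :> 'F_2)%R.
  have [Xx|Xx] := boolP (x \in X).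
    by rewrite (bigD1 x) //= eqxx big1 ?addr0 // => v /andP[_ /negPf->].
  by rewrite big1 // => v Xv; case: eqP Xv Xx => // -> ->.
rewrite sumrB !sum_mem inE.
case: (s e \in X); case: (t e \in X) => /=; rewrite ?subrr ?subr0 ?mulr0 ?mulr1 //.
rewrite sub0r mulrN1; apply/eqP.
by rewrite -addr_eq0 -mulr2n -mulr_natr pchar_Zp // mulr0.
Qed.

(* Let [k] be the number of components of the graph with edge set [R :|: ~: N] that
   have a nonempty cut. The representatives of these components generate, modulo
   [relspan R], a space that contains all boundaries, so [relspan R] has codimension
   at most [k]; on the other hand at least [4 k / 2] edges join two components. *)
Lemma dim_relspan_le_cuts N R (U := relspan boundary 0 (~: N)) :
  (forall X, cut X \subset N -> (#|cut X| == 0) || (4 <= #|cut X|)) ->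
  2 * \dim (relspan boundary U setT) <= 2 * \dim (relspan boundary U R) + #|~: R|.
Proof.
move=> cutN; pose F := R :|: ~: N.
pose adj u v := [exists e in F, (s e == u) && (t e == v) || (s e == v) && (t e == u)].
have adj_sym : symmetric adj.
  by move=> u v; apply: eq_existsb => e; rewrite orbC.
have conn_sym := sym_connect_sym adj_sym.
pose rt := fingraph.root adj; pose cl r := [set v | rt v == r].
have rtE e : e \in F -> rt (s e) = rt (t e).
  move=> Fe; apply/(fingraph.rootP conn_sym)/connect1/existsP; exists e.
  by rewrite Fe !eqxx.
have cutE r e : (e \in cut (cl r)) = ((rt (s e) == r) != (rt (t e) == r)).
  by rewrite !inE.
pose L := [set r | cut (cl r) != set0].
set W := relspan boundary U R.
have WF e : e \in F -> boundary e \in W.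
  case/setUP=> [|eN]; first exact: mem_relspan.
  by apply: subvP (subU_relspan _ _ _) _ _; apply: mem_relspan.
have Wconn u v : connect adj u v -> (ind u - ind v)%R \in W.
  move: v; apply: connect_ind => [|v w _ uv /existsP[e /andP[Fe jvw]]].
    by rewrite subrr mem0v.
  have -> : (ind u - ind w = (ind u - ind v) + (ind v - ind w))%R.
    by rewrite addrA subrK.
  apply: memvD uv _; have := WF e Fe; rewrite /boundary.
  by case/orP: jvw => /andP[/eqP<- /eqP<-] //; rewrite -memvN opprB.
have Wrt v : (ind v - ind (rt v))%R \in W by apply/Wconn/connect_root.
have dimT : \dim (relspan boundary U setT) <= \dim W + #|L|.
  pose W' := (W + \sum_(r in L) <[ind r]>)%VS.
  have : (relspan boundary U setT <= W')%VS.
    rewrite sub_relspan (subv_trans (subU_relspan _ _ _) (addvSl _ _)) /=.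
    apply/forall_inP=> e _; have [same|diff] := eqVneq (rt (s e)) (rt (t e)).
      apply: subvP (addvSl _ _) _ _.
      have -> : boundary e = ((ind (s e) - ind (rt (s e)))
                              - (ind (t e) - ind (rt (t e))))%R.
        by rewrite same opprB addrA subrK.
      exact: memvB.
    have inL r : (rt (s e) == r) || (rt (t e) == r) -> ind r \in W'.
      move=> er; apply: subvP (addvSr _ _) _ _; apply: subvP (sumv_sup r _ _) _ _ => //.
        rewrite inE; apply/set0Pn; exists e; rewrite cutE.
        by case: eqP er diff => [<-|_ /= ->] //; rewrite eq_sym => _ /negPf->.
      exact: memv_line.
    have inW' v : (rt (s e) == rt v) || (rt (t e) == rt v) -> ind v \in W'.
      move=> /inL vL; rewrite -(subrK (ind (rt v)) (ind v)); apply: memvD => //.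
      exact: subvP (addvSl _ _) _ _.
    by apply: memvB; apply: inW'; rewrite eqxx ?orbT.
  move/dimvS/leq_trans; apply; apply: leq_trans (dimv_add_leqif _ _) _.
  rewrite leq_add2l; apply: leq_trans (dimv_leq_sum _ _ _) _.
  by rewrite -sum1_card; apply: leq_sum => r _; rewrite dim_vline leq_b1.
have cutL : 4 * #|L| <= 2 * #|~: R|.
  apply: (@leq_trans (\sum_(r in L) #|cut (cl r)|)).
    rewrite mulnC -sum_nat_const; apply: leq_sum => r; rewrite inE => r0.
    have : cut (cl r) \subset N.
      apply/subsetP=> e; rewrite cutE; apply: contraR => eN.
      by rewrite rtE // !inE eN orbT.
    by move/cutN; rewrite cards_eq0 (negPf r0).
  under eq_bigr => r _ do rewrite card_sum_mem.
  rewrite exchange_big /= card_sum_mem big_distrr /=; apply: leq_sum => e _.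
  have [eR|eR] := boolP (e \in R).
    by rewrite big1 // => r _; rewrite cutE rtE ?eqxx // inE eR.
  rewrite inE eR muln1.
  apply: leq_trans (_ : \sum_r ((rt (s e) == r) + (rt (t e) == r)) <= 2).
    rewrite big_mkcond; apply: leq_sum => r _; case: ifP => // _; rewrite cutE.
    by do 2!case: (_ == r).
  rewrite big_split /=.
  have sum_eq x : \sum_r (x == r) = 1.
    by rewrite (bigD1 x) //= eqxx big1 // => r; rewrite eq_sym => /negPf->.
  by rewrite !sum_eq.
move: dimT cutL; move: (\dim _) (\dim _) #|L| #|~: R| => a b c x; clear; lia.
Qed.

(** The boundary of [N :\: A] is cancelled by a combination of edges in [A] and outside [N], which
    leaves the value 1 on [N :\: A]. *)
Lemma ex_flow_spanning N A (U := relspan boundary 0 (~: N)) :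
  relspan boundary U A = relspan boundary U setT ->
  exists2 y : E -> 'F_2, flow y & {in N :\: A, forall e, y e = 1%R}.
Proof.
move=> spanA; set z := (\sum_(e in N :\: A) boundary e)%R.
have : z \in relspan boundary U A.
  rewrite spanA; apply: memv_suml => e _; exact: mem_relspan.
(* [c] gives the coefficients on [A]; the remainder lies in [U], which is itself a span, and [c']
   expands it over [~: N]. *)
case/relspan_coef=> c; case/relspan_coef=> c'; rewrite memv0 => /eqP zE.
pose y e : 'F_2 := ((e \in N :\: A)%:R - (e \in A)%:R * c e - (e \in ~: N)%:R * c' e)%R.
exists y; last first.
  move=> e eNA; rewrite /y eNA; move: eNA; rewrite !inE => /andP[/negPf-> ->].
  by rewrite !mul0r !subr0.
have mkcond (B : {set E}) (f : E -> 'rV['F_2]_#|V|) :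
    (\sum_(e in B) f e = \sum_e (e \in B)%:R *: f e)%R.
  rewrite big_mkcond; apply: eq_bigr => e _.
  by case: (_ \in B); rewrite ?scale1r ?scale0r.
apply: flow_boundary; rewrite -[RHS]zE /z !mkcond -!sumrB.
by apply: eq_bigr => e _; rewrite /y !scalerBl -!scalerA.
Qed.

Lemma ex_flow_nz_of_cuts_ge4 N :
  (forall X, cut X \subset N -> (#|cut X| == 0) || (4 <= #|cut X|)) ->
  exists2 y : E -> 'F_2 * 'F_2, flow y & {in N, forall e, y e != 0%R}.
Proof.
move=> cutN; pose U := relspan boundary 0 (~: N).
have cond R : #|{: bool}| * \dim (relspan boundary U setT)
              <= #|{: bool}| * \dim (relspan boundary U R) + #|~: R|.
  by rewrite card_bool; apply: dim_relspan_le_cuts.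
have [p pspan] := spanning_packing cond.
have [y1 flow1 y1N] := ex_flow_spanning (pspan true).
have [y2 flow2 y2N] := ex_flow_spanning (pspan false).
exists (fun e => (y1 e, y2 e)) => [X|e Ne].
  rewrite [LHS]surjective_pairing !raddf_sum /=.
  by rewrite (flow1 X) (flow2 X).
rewrite xpair_eqE; have [p1|p1] := boolP (e \in part p true); last first.
  rewrite y1N ?andbT; last by rewrite inE Ne p1.
  by rewrite oner_eq0.
by rewrite y2N ?andbF // !inE Ne andbT; move: p1; rewrite inE => /eqP->.
Qed.

Theorem ex_flow_nz N :
  (forall X, cut X \subset N -> (#|cut X| != 1) && (#|cut X| != 3)) ->
  exists2 y : E -> 'F_2 * 'F_2, flow y & {in N, forall e, y e != 0%R}.
Proof.
have [n] := ubnP #|N|; elim: n N => // n IHn N ltNn cutN.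
have [/existsP[X /andP[XN /cards2P[e [e' [nee' defX]]]]]|no2] :=
  boolP [exists X : {set V}, (cut X \subset N) && (#|cut X| == 2)]; last first.
  apply: ex_flow_nz_of_cuts_ge4 => X XN; have := cutN X XN.
  have : #|cut X| != 2.
    by apply: contraNneq no2 => X2; apply/existsP; exists X; rewrite XN X2.
  by case: #|_| => [|[|[|[|]]]].
have [/subsetP XN' ee'] : cut X \subset N /\ e != e' by [].
have Ne : e \in N by apply: XN'; rewrite defX !inE eqxx.
have Ne' : e' \in N by apply: XN'; rewrite defX !inE eqxx orbT.
have [||y flowy yN] := IHn (N :\ e).
- by move: ltNn; rewrite (cardsD1 e) Ne.
- by move=> Z ZN; apply: cutN; apply: subset_trans ZN (subsetDl _ _).
exists y => // f Nf; have [->|fe] := eqVneq f e; last by apply: yN; rewrite !inE fe.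
have := flowy X; rewrite defX big_setU1 ?inE //= big_set1 => /eqP.
rewrite addr_eq0 => /eqP->; rewrite oppr_eq0; apply: yN.
by rewrite !inE eq_sym nee'.
Qed.

End Flow.

(** * Merging two colors *)

(** Sending a root for [F'] to its root for [F] is injective. If it were onto, the components of [u]
    and [v] for [F] would come from the same root for [F'], hence coincide. *)
Lemma num_components_lt (G : multigraph) (F F' : {set edge G}) (u v : vertex G) :
  F \subset F' -> connect (adj F') u v -> ~~ connect (adj F) u v ->
  num_components F' < num_components F.
Proof.
have adj_csym H : connect_sym (@adj G H).
  by apply: sym_connect_sym => x y; apply: eq_existsb => e; rewrite setUC.
move=> FF' cuv nuv; rewrite /num_components.
have sub x y : connect (adj F) x y -> connect (adj F') x y.
  apply: connect_sub => {}x {}y /existsP[e /andP[Fe xy]].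
  by apply/connect1/existsP; exists e; rewrite (subsetP FF').
pose h := fingraph.root (adj F).
have csubh x : connect (adj F') x (h x) by apply/sub/connect_root.
set A := [set x | roots (adj F') x]; set B := [set x | roots (adj F) x].
have eqA H : n_comp_mem (adj H) (mem (vertex G)) = #|[set x | roots (@adj G H) x]|.
  by apply: eq_card => x; rewrite !inE andbT.
rewrite !{}eqA -/A -/B.
have h_inj : {in A &, injective h}.
  move=> x y; rewrite !inE => /eqP rx /eqP ry hxy.
  rewrite -rx -ry; apply/(fingraph.rootP (adj_csym _)).
  by apply: connect_trans (csubh x) _; rewrite hxy adj_csym.
have hB : h @: A \subset B.
  by apply/subsetP=> _ /imsetP[x _ ->]; rewrite inE; apply/roots_root/adj_csym.
rewrite -(card_in_imset h_inj); apply: proper_card; rewrite properEneq hB andbT.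
apply: contra nuv => /eqP defB.
have inB x : h x \in h @: A by rewrite defB inE; apply/roots_root/adj_csym.
have /imsetP[x Ax hux] := inB u; have /imsetP[y Ay hvy] := inB v.
apply/(fingraph.rootP (adj_csym _)); rewrite -/h hux hvy; congr h.
have rt := fingraph.rootP (adj_csym F').
move: Ax Ay; rewrite !inE => /eqP<- /eqP<-; apply/rt.
have sym := adj_csym F'.
apply: connect_trans (csubh x) _; rewrite -hux sym.
apply: connect_trans (csubh u); rewrite sym.
apply: connect_trans cuv _; rewrite sym.
by apply: connect_trans (csubh y) _; rewrite -hvy sym.
Qed.

Local Notation klein := (bool * bool)%type.

(** The Klein group on pairs of booleans, so that facts about colors are decided by enumeration. *)
Definition kadd (a b : klein) : klein := (a.1 (+) b.1, a.2 (+) b.2).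

Lemma kaddK a b : kadd (kadd a b) b = a.
Proof. by case: a b => [[] []] [[] []]. Qed.

Definition cycle_color (a : klein) : 'I_6 :=
  match a with
  | (false, false) => @Ordinal 6 0 isT
  | (false, true) => @Ordinal 6 1 isT
  | (true, false) => @Ordinal 6 2 isT
  | (true, true) => @Ordinal 6 3 isT
  end.

(* The values other than [p] share a color. *)
Definition matching_color (p m : klein) : 'I_6 :=
  if m == p then @Ordinal 6 4 isT else @Ordinal 6 5 isT.

Definition star_colors (p m a : klein) : seq 'I_6 :=
  [:: matching_color p m; cycle_color a; cycle_color (kadd a m)].

Definition normal_colors (s : seq 'I_6) :=
  (size (undup s) == 3) || (size (undup s) == 5).

(** The pairs [a], [a + m] and [b], [b + m] are cosets of the same subgroup: equal or disjoint, they
    give 3 or 5 colors in all. *)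
Lemma normal_matching_edge (p m a b : klein) : m != (false, false) ->
  normal_colors (star_colors p m a ++ star_colors p m b).
Proof. by case: p m a b => [[] []] [[] []] [[] []] [[] []]. Qed.

(** If [m = n] the two stars coincide. Otherwise the nonzero values are [m], [n] and [m + n], so [p]
    is [m] or [n]; the matching colors differ, and there are 5 colors. *)
Lemma normal_cycle_edge (p m n a : klein) :
  p != (false, false) -> m != (false, false) -> n != (false, false) -> p != kadd m n ->
  normal_colors (star_colors p m a ++ star_colors p n a).
Proof. by case: p m n a => [[] []] [[] []] [[] []] [[] []]. Qed.

Lemma uniq_star_colors (p m a : klein) :
  m != (false, false) -> uniq (star_colors p m a).
Proof. by case: p m a => [[] []] [[] []] [[] []]. Qed.

Definition klein_of (x : 'F_2 * 'F_2) : klein := (x.1 != 0%R, x.2 != 0%R).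

Lemma klein_of_sum x y z :
  (x + y + z = 0)%R -> klein_of z = kadd (klein_of y) (klein_of x).
Proof.
case: x y z => [[[|[|//]] ?] [[|[|//]] ?]] [[[|[|//]] ?] [[|[|//]] ?]];
by case=> [[[|[|//]] ?] [[|[|//]] ?]].
Qed.

Lemma klein_of_eq0 x : (klein_of x == (false, false)) = (x == 0%R).
Proof. by case: x => [[[|[|//]] ?] [[|[|//]] ?]]. Qed.

(** * The coloring given by a perfect matching and a flow *)

Section Coloring.
Variables (G : multigraph) (s t : edge G -> vertex G).
Hypothesis endsE : forall e, ends e = [set s e; t e].
Hypothesis loopless : forall e, s e != t e.
Hypothesis cubicG : cubic G.
Variable M : {set edge G}.
Hypothesis M_perfect : forall v, #|M :&: cut s t [set v]| = 1.
Variable y : edge G -> 'F_2 * 'F_2.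
Hypothesis flow_y : flow s t y.
Hypothesis y_nz : {in M, forall e, y e != 0%R}.
Implicit Types (p : klein) (e : edge G) (v : vertex G).

Lemma incident_cut v : incident v = cut s t [set v].
Proof.
apply/setP=> e; rewrite !inE endsE !inE; have := loopless e.
rewrite [v == s e]eq_sym [v == t e]eq_sym.
have [<-|_] := eqVneq (s e) v; last by case: (t e == v).
by rewrite eq_sym => /negPf->.
Qed.

Let value e := klein_of (y e).

Definition merged_coloring p e : 'I_6 :=
  if e \in M then matching_color p (value e) else cycle_color (value e).

Definition is_star v (g : edge G * (edge G * edge G)) :=
  [&& incident v == [set g.1; g.2.1; g.2.2], uniq [:: g.1; g.2.1; g.2.2],
      M :&: incident v == [set g.1], value g.1 != (false, false) &
      value g.2.2 == kadd (value g.2.1) (value g.1)].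

Lemma ex_star v : exists g, is_star v g.
Proof.
have := M_perfect v; rewrite -incident_cut => /eqP/cards1P[m Mv].
have /setIP[Mm vm] : m \in M :&: incident v by rewrite Mv set11.
have : #|incident v :\ m| == 2.
  by have := cubicG v; rewrite (cardsD1 m) vm add1n => -[->].
case/cards2P=> a [b [ab def]].
have defI : incident v = m |: [set a; b] by rewrite -def setD1K.
have [am bm] : a != m /\ b != m.
  have: a \in incident v :\ m by rewrite def !inE eqxx.
  have: b \in incident v :\ m by rewrite def !inE eqxx orbT.
  by rewrite !inE => /andP[-> _] /andP[-> _].
exists (m, (a, b)); rewrite /is_star /= Mv eqxx /=; apply/and4P; split.
- by rewrite defI setUA.
- by rewrite !inE negb_or ab ![m == _]eq_sym am bm.
- by rewrite klein_of_eq0 y_nz.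
apply/eqP/klein_of_sum; have := flow_y [set v]; rewrite -incident_cut defI.
have ma : m \notin [set a; b] by rewrite !inE negb_or ![m == _]eq_sym am bm.
have a_b : a \notin [set b] by rewrite inE.
by rewrite (big_setU1 _ ma) /= (big_setU1 _ a_b) /= big_set1 addrA.
Qed.

Definition star v := xchoose (ex_star v).
Definition matching_value v : klein := value (star v).1.

Lemma starP v : [/\ incident v = [set (star v).1; (star v).2.1; (star v).2.2],
    uniq [:: (star v).1; (star v).2.1; (star v).2.2],
    M :&: incident v = [set (star v).1], value (star v).1 != (false, false) &
    value (star v).2.2 = kadd (value (star v).2.1) (value (star v).1)].
Proof. by have /and5P[/eqP ? ? /eqP ? ? /eqP ?] := xchooseP (ex_star v). Qed.

Lemma matching_value_neq0 v : matching_value v != (false, false).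
Proof. by have [] := starP v. Qed.

Lemma matching_valueE v e : e \in M -> e \in incident v -> value e = matching_value v.
Proof.
move=> Me ve; have [_ _ Mv _ _] := starP v.
by have /set1P-> : e \in [set (star v).1] by rewrite -Mv inE Me.
Qed.

Lemma merged_coloring_star p v :
  [seq merged_coloring p e | e <- [:: (star v).1; (star v).2.1; (star v).2.2]]
  = star_colors p (matching_value v) (value (star v).2.1).
Proof.
have [defI unq Mv _ valE] := starP v.
have Mg : (star v).1 \in M.
  by have /setIP[] : (star v).1 \in M :&: incident v by rewrite Mv set11.
have nM e : e \in incident v -> (star v).1 != e -> e \notin M.
  move=> ve; apply: contra_neqN => Me; apply/esym/set1P.
  by rewrite -Mv inE Me.
move: unq; rewrite /= !inE negb_or andbT => /andP[/andP[ga gb] _].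
by rewrite /merged_coloring Mg !(negPf (nM _ _ _)) ?valE // defI !inE eqxx ?orbT.
Qed.

Lemma colors_at_star p v : colors_at (merged_coloring p) v =
  [set x in star_colors p (matching_value v) (value (star v).2.1)].
Proof.
rewrite -merged_coloring_star; have [defI _ _ _ _] := starP v.
rewrite /colors_at defI !imsetU !imset_set1; apply/setP=> x.
by rewrite !inE orbA.
Qed.

(** Replacing [a] by [a + m] only swaps the last two colors of a star, so either edge outside [M]
    can serve as reference. *)
Lemma colors_at_cycle p v e : e \in incident v -> e \notin M ->
  colors_at (merged_coloring p) v =
  [set x in star_colors p (matching_value v) (value e)].
Proof.
move=> ve Me; rewrite colors_at_star; have [defI _ Mv _ valE] := starP v.
move: ve; rewrite defI !inE -orbA => /or3P[] /eqP de.
- have /setIP[] : (star v).1 \in M :&: incident v by rewrite Mv set11.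
  by rewrite -de (negPf Me).
- by rewrite -de.
apply/setP=> x; rewrite de valE !inE kaddK.
by congr (_ || _); rewrite orbC.
Qed.

Lemma merged_coloring_proper p : edge_coloring (merged_coloring p).
Proof.
move=> v e1 e2 v1 v2; apply: contra_neq; apply: (imset_injP _) v1 v2.
rewrite -/(colors_at _ v) colors_at_star card_set_undup cubicG undup_id //.
exact/uniq_star_colors/matching_value_neq0.
Qed.

Lemma mem_normal_edges p e l :
  colors_at (merged_coloring p) (s e) :|: colors_at (merged_coloring p) (t e)
    = [set x in l] ->
  normal_colors l -> e \in normal_edges (merged_coloring p).
Proof.
move=> defl; rewrite inE /poor /rich /colors_around endsE.
by rewrite big_setU1 ?inE //= big_set1 defl card_set_undup.
Qed.

Lemma incident_ends e : e \in incident (s e) /\ e \in incident (t e).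
Proof. by rewrite !inE endsE !inE !eqxx orbT. Qed.

Lemma matching_edge_normal p e : e \in M -> e \in normal_edges (merged_coloring p).
Proof.
move=> Me; have [se te] := incident_ends e.
apply: mem_normal_edges; first by rewrite !colors_at_star set_cat.
rewrite -(matching_valueE Me se) -(matching_valueE Me te).
by apply: normal_matching_edge; rewrite (matching_valueE Me se) matching_value_neq0.
Qed.

Lemma cycle_edge_normal p e : e \notin M -> p != (false, false) ->
  p != kadd (matching_value (s e)) (matching_value (t e)) ->
  e \in normal_edges (merged_coloring p).
Proof.
move=> Me p0 pe; have [se te] := incident_ends e.
apply: mem_normal_edges.
  by rewrite (colors_at_cycle p se Me) (colors_at_cycle p te Me) set_cat.
by apply: normal_cycle_edge; rewrite ?matching_value_neq0.
Qed.

Lemma sum_card_incident (A : {set edge G}) :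
  \sum_v #|A :&: incident v| = 2 * #|A|.
Proof.
under eq_bigr => v _ do rewrite card_sum_mem.
rewrite exchange_big /= card_sum_mem big_distrr /=; apply: eq_bigr => e _.
under eq_bigr => v _ do rewrite !inE.
case: (e \in A) => /=; last by rewrite big1.
by rewrite -card_sum_mem card_ends.
Qed.

Lemma card_matching : 3 * #|M| = #|edge G|.
Proof.
have := sum_card_incident M; have := sum_card_incident setT.
rewrite cardsT; under eq_bigr => v _ do rewrite setTI cubicG.
under [in X in _ -> X]eq_bigr => v _ do rewrite incident_cut M_perfect.
by rewrite !sum_nat_const; lia.
Qed.

Lemma ex_merged_coloring : exists f : edge G -> 'I_6,
  edge_coloring f /\ 7 * #|edge G| <= 9 * #|normal_edges f|.
Proof.
pose p1 : klein := (true, false); pose p2 : klein := (false, true).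
pose p3 : klein := (true, true).
pose bad p := ~: normal_edges (merged_coloring p).
have cbad p : #|normal_edges (merged_coloring p)| + #|bad p| = #|edge G|.
  exact: cardsC.
have sum_bad : #|bad p1| + #|bad p2| + #|bad p3| <= #|~: M|.
  rewrite !card_sum_mem -!big_split /=; apply: leq_sum => e _.
  rewrite [e \in ~: M]inE; have [Me|Me] := boolP (e \in M).
    by rewrite ![e \in bad _]inE !matching_edge_normal.
  have H p : p != (false, false) ->
      (e \in bad p) <= (p == kadd (matching_value (s e)) (matching_value (t e))).
    move=> p0; rewrite inE; case: eqVneq => [_|pe]; first exact: leq_b1.
    by rewrite cycle_edge_normal.
  apply: leq_trans (leq_add (leq_add (H p1 isT) (H p2 isT)) (H p3 isT)) _.
  by case: (kadd _ _) => [[] []].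
have := card_matching; have := cardsC M.
(* The threshold is a third of [#|~: M|], which is two thirds of the number of edges; if [p1] and
   [p2] exceed it, [p3] cannot. *)
have [le1|gt1] := leqP (9 * #|bad p1|) (2 * #|edge G|).
  exists (merged_coloring p1); split; first exact: merged_coloring_proper.
  by have := cbad p1; lia.
have [le2|gt2] := leqP (9 * #|bad p2|) (2 * #|edge G|).
  exists (merged_coloring p2); split; first exact: merged_coloring_proper.
  by have := cbad p2; lia.
exists (merged_coloring p3); split; first exact: merged_coloring_proper.
by have := cbad p3; lia.
Qed.

End Coloring.

Local Open Scope ring_scope.

Theorem theorem7 (G : multigraph) (hcubic : cubic G) (hbridgeless : bridgeless G) :
  exists f : edge G -> 'I_6,
    edge_coloring f /\
    (#|normal_edges f|%:R : rat) >= 7 / 9 * #|edge G|%:R.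
Proof.
suff [f [colf le_f]] : exists f : edge G -> 'I_6,
    edge_coloring f /\ (7 * #|edge G| <= 9 * #|normal_edges f|)%N.
  exists f; split=> //; move: le_f; rewrite -(ler_nat rat) !natrM; lra.
(* An edge is needed to prescribe to the matching; without edges the bound is trivial. *)
have [E0|[e0 _]] := set_0Vmem [set: edge G].
  exists (fun=> ord0); split=> [v e1|]; last by rewrite -cardsT E0 cards0.
  by have := in_setT e1; rewrite E0 inE.
have ex_ends (e : edge G) :
    exists p, (ends e == [set p.1; p.2]) && (p.1 != p.2) :> bool.
  have /eqP/cards2P[u [v [uv ->]]] := card_ends e.
  by exists (u, v); rewrite /= eqxx.
pose s e := (xchoose (ex_ends e)).1; pose t e := (xchoose (ex_ends e)).2.
have endsE e : ends e = [set s e; t e] by have /andP[/eqP] := xchooseP (ex_ends e).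
have loopless e : s e != t e by have /andP[] := xchooseP (ex_ends e).
have incE := incident_cut endsE loopless.
have cubG : cubic_on s t setT.
  split=> [e|v _|X]; first by rewrite !inE.
    by rewrite -incE.
  (* If [e] is the only edge of a cut, then [X] is closed under adjacency once [e] is deleted, so
     the ends of [e] get disconnected and [e] is a bridge. *)
  apply/negP=> /cards1P[e defX]; have /negP := hbridgeless e; apply.
  apply: (@num_components_lt _ _ _ (s e) (t e)); first exact: subsetT.
    by apply/connect1/existsP; exists e; rewrite inE endsE eqxx.
  have clX : closed (adj [set~ e]) X.
    move=> u v /existsP[f /andP[]]; rewrite inE => /set1P fe /eqP.
    have : f \notin cut s t X by rewrite defX; apply/set1P.
    rewrite inE negbK endsE => /eqP stX defuv.
    have : u \in [set s f; t f] by rewrite defuv !inE eqxx.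
    have : v \in [set s f; t f] by rewrite defuv !inE eqxx orbT.
    by rewrite !inE => /orP[]/eqP-> /orP[]/eqP->; rewrite ?stX.
  apply/negP=> /(closed_connect clX) stX.
  by have := set11 e; rewrite -defX inE stX eqxx.
have [M _ tightM] := tight_perfect_matching cubG (loopless e0).
have M_perfect v : #|M :&: cut s t [set v]| = 1%N.
  by apply: (elimT (tightP s t M [set v]) (tightM _)); rewrite -incE.
have [|y flow_y y_nz] := @ex_flow_nz _ _ s t M.
  (* A 3-edge cut contained in [M] would meet [M] three times, while tightness allows one. *)
  move=> X XM; have [_ _ neq1] := cubG; rewrite neq1 /=; apply/eqP=> X3.
  have := elimT (tightP s t M X) (tightM X) X3.
  by rewrite (setIidPr XM) X3.
exact (ex_merged_coloring endsE loopless hcubic M_perfect flow_y y_nz).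
Qed.
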